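(* Let $K_1\subseteq\mathcal{M}(E_1)$ and $K_2\subseteq\mathcal{M}(E_2)$ be compact nc convex sets. Then there is a natural complete order isomorphism $$A(K_1\times K_2)\cong A(K_1)\oplus_1A(K_2).$$ Here $a\oplus_1b\in A(K_1)\oplus_1A(K_2)$ corresponds to the continuous nc affine function $$(a\oplus_1b)(x,y)=a(x)+b(y),\qquad (x,y)\in K_1\times K_2.$$
   Context: Fix an infinite cardinal $\kappa$, sufficiently large (at least the density characters of the spaces involved). For a cardinal $n\le\kappa$, $M_n=B(H_n)$ with $H_n$ a Hilbert space of dimension $n$, and $M_{p,n}=B(H_n,H_p)$. For a dual operator space $E=(E_* )^*$, $M_n(E)$ is identified with the space $CB(E_*,M_n)$ of completely bounded maps, with its weak-$*$ topology (point-weak-$*$ on bounded sets), and $(\alpha x\beta)(e)=\alpha x(e)\beta$. Put $\mathcal{M}(E)=\coprod_{n\le\kappa}M_n(E)$ and $\mathcal{M}=\mathcal{M}(\mathbb{C})$. $E_1,E_2$ are dual operator spaces. $K\subseteq\mathcal{M}(E)$, with levels $K(n)=K\cap M_n(E)$, is nc convex if it is closed under direct sums (of norm-bounded families) and compressions by isometries; equivalently $\sum_i\alpha_i^*x_i\alpha_i\in K(n)$ whenever $(x_i)$ is a norm-bounded family, $x_i\in K(n_i)$, $\alpha_i\in M_{n_i,n}$, $\sum_i\alpha_i^*\alpha_i=I_n$ (weak-$*$ convergent). It is a compact nc convex set if moreover each $K(n)$ is weak-$*$ compact. Compact nc convex sets are taken nonempty. The product $K_1\times K_2=\coprod_nK_1(n)\times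 K_2(n)\subseteq\mathcal{M}(E_1\times E_2)$ (with $E_1\times E_2$ the $\ell^\infty$-product) is again a compact nc convex set, with the product topology on each level. A map between nc convex sets is an nc function if it is graded (level $n$ to level $n$), preserves direct sums and preserves unitary equivalence; it is nc affine if also $a(\alpha^*x\alpha)=\alpha^*a(x)\alpha$ for all isometries $\alpha$; it is continuous if weak-$*$ continuous on each level. $A(K)$ is the operator system of continuous nc affine functions $K\to\mathcal{M}$, with $a^*(x)=a(x)^*$, unit $1(x)=1_{M_n}$ for $x\in K(n)$, and pointwise order on $M_n(A(K))$. For operator systems $S,T$, the unital direct sum is $S\oplus_1T=(S\times T)/\mathbb{C}((1_S,0)-(0,1_T))$. For finite $n$, $M_n(S\oplus_1T)$ is identified with $(M_n(S)\times M_n(T))/M_n(\mathbb{C}((1_S,0)-(0,1_T)))$, the class of $(s,t)$ is written $s\oplus_1t$, and $s\oplus_1t\ge0$ if and only if there is $\lambda\in M_n(\mathbb{C})$ with $s-\lambda\ge0$ and $t+\lambda\ge0$ (where $\lambda$ denotes $\lambda\otimes1_S$, resp. $\lambda\otimes1_T$). *)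

(* Defs.v *)
From HB Require Import structures.
From mathcomp Require Import all_boot all_order all_algebra.
From mathcomp Require Import complex.
From mathcomp Require Import all_classical reals topology normedtype.
From mathcomp Require Import generic_quotient ring_quotient ring lra.
Set Implicit Arguments.
Unset Strict Implicit.
Unset Printing Implicit Defensive.
Import Order.TTheory GRing.Theory Num.Theory.
Import numFieldNormedType.Exports.
Local Open Scope classical_set_scope.
Local Open Scope ring_scope.
Local Open Scope card_scope.


(* All norms are valued in the complex field R[i], ordered so that 0 <= z      *)
(* means that z is real and nonnegative.                                      *)
HB.mixin Record isHilbert (R : realType) H of CompleteNormedModule R[i] H := {
  inner : H -> H -> R[i];
  inner_scalarl : forall v, scalar (inner^~ v);
  inner_conj : forall u v, inner u v = (inner v u)^*;
  inner_norm : forall u, inner u u = `|u| ^+ 2 }.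
#[short(type="hilbertType")]
HB.structure Definition Hilbert (R : realType) :=
  {H of isHilbert R H & CompleteNormedModule R[i] H}.

Section Riesz.
Context {R : realType}.
Implicit Types (z : R[i]) (t e : R).
Local Notation rc t := (real_complex R t).

Lemma ge0_rc z : 0 <= z -> z = rc (complex.Re z).
Proof. by case: z => a b; rewrite lecE /= => /andP[/eqP -> _]. Qed.

Lemma ler_rc t e : (rc t <= rc e) = (t <= e).
Proof. by rewrite lecE /= eqxx. Qed.

Lemma ltr_rc t e : (rc t < rc e) = (t < e).
Proof. by rewrite ltcE /= eqxx. Qed.

Lemma rcM t e : rc (t * e) = rc t * rc e.
Proof. exact: rmorphM. Qed.

Lemma Re_conj z : complex.Re z^* = complex.Re z.
Proof. by case: z. Qed.

Lemma ReD z z' : complex.Re (z + z') = complex.Re z + complex.Re z'.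
Proof. by case: z; case: z'. Qed.

Lemma ReMl t z : complex.Re (rc t * z) = t * complex.Re z.
Proof. by case: z => a b /=; rewrite mul0r subr0. Qed.

Lemma ReMi z : complex.Re ('i * z) = - complex.Im z.
Proof. by case: z => a b /=; rewrite mul0r mul1r sub0r. Qed.

Lemma Re_le_norm z : rc `|complex.Re z| <= `|z|.
Proof.
case: z => a b; rewrite normc_def ler_rc -sqrtr_sqr ler_sqrt; last first.
  by rewrite addr_ge0 ?sqr_ge0.
by rewrite lerDl sqr_ge0.
Qed.

Context {H : hilbertType R}.
Implicit Types u v w : H.

Lemma innerDl u v w : inner (u + v) w = inner u w + inner v w.
Proof. by have := inner_scalarl w 1 u v; rewrite scale1r mul1r. Qed.

Lemma inner0l w : inner 0 w = 0 :> R[i].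
Proof. by apply: (addIr (inner 0 w)); rewrite -innerDl !add0r. Qed.

Lemma innerZl (c : R[i]) u w : inner (c *: u) w = c * inner u w.
Proof. by have := inner_scalarl w c u 0; rewrite !addr0 inner0l addr0. Qed.

Lemma innerNl u w : inner (- u) w = - inner u w.
Proof. by rewrite -scaleN1r innerZl mulN1r. Qed.

Lemma innerDr u v w : inner w (u + v) = inner w u + inner w v.
Proof. by rewrite inner_conj innerDl rmorphD /= -!inner_conj. Qed.

Lemma innerZr (c : R[i]) u w : inner w (c *: u) = c^* * inner w u.
Proof. by rewrite inner_conj innerZl rmorphM /= -!inner_conj. Qed.

Lemma innerNr u w : inner w (- u) = - inner w u.
Proof. by rewrite inner_conj innerNl rmorphN /= -!inner_conj. Qed.

Lemma inner_ext u v : (forall w, inner u w = inner v w) -> u = v.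
Proof.
move=> uv; apply/eqP; rewrite -subr_eq0 -normr_eq0 -sqrf_eq0 -inner_norm.
by rewrite {1}innerDl innerNl uv subrr.
Qed.

Lemma inner_extr u v : (forall w, inner w u = inner w v) -> u = v.
Proof. by move=> uv; apply: inner_ext => w; rewrite inner_conj uv -inner_conj. Qed.

Let nr u : R := complex.Re `|u|.
Let p u v : R := complex.Re (inner u v).

Let nrE u : `|u| = rc (nr u). Proof. exact: ge0_rc. Qed.
Let nr_ge0 u : 0 <= nr u. Proof. by rewrite -ler_rc -nrE; exact: normr_ge0. Qed.
Let pDl u v w : p (u + v) w = p u w + p v w. Proof. by rewrite /p innerDl ReD. Qed.
Let pZl t u w : p (rc t *: u) w = t * p u w. Proof. by rewrite /p innerZl ReMl. Qed.
Let pC u v : p u v = p v u. Proof. by rewrite /p inner_conj Re_conj. Qed.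
Let pNl u w : p (- u) w = - p u w.
Proof. by rewrite /p innerNl; case: (inner u w). Qed.
Let pnr u : p u u = nr u ^+ 2.
Proof. by rewrite /p inner_norm nrE -rmorphXn. Qed.

Let pexp t u v : nr (u + rc t *: v) ^+ 2 = nr u ^+ 2 + 2 * t * p v u + t ^+ 2 * nr v ^+ 2.
Proof.
rewrite -!pnr pDl pZl (pC u) (pC v (_ + _)) !pDl !pZl (pC u v); ring.
Qed.

Let quad (a b c : R) : 0 <= a -> (forall t, 0 <= c + 2 * t * b + t ^+ 2 * a) -> b ^+ 2 <= a * c.
Proof.
move=> a0 q; case: (eqVneq a 0) => [a_0|a_n0].
  have [->|b_n0] := eqVneq b 0; first by rewrite expr0n a_0 mul0r.
  have := q (- (c + 1) / (2 * b)); rewrite a_0 mulr0 addr0 => h.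
  have E : c + 2 * (- (c + 1) / (2 * b)) * b = -1 by field.
  by move: h; rewrite E; lra.
have a_gt0 : 0 < a by rewrite lt_def a_n0.
have := q (- b / a).
have -> : c + 2 * (- b / a) * b + (- b / a) ^+ 2 * a = c - b ^+ 2 / a by field.
by rewrite subr_ge0 ler_pdivrMr // mulrC.
Qed.

Let cs u v : `|p u v| <= nr u * nr v.
Proof.
rewrite -(@ler_pXn2r _ 2) ?nnegrE ?mulr_ge0 //.
rewrite real_normK ?num_real // exprMn.
by apply: quad => [|t]; rewrite ?sqr_ge0 // -pexp sqr_ge0.
Qed.

Lemma riesz (f : H -> R[i]) (M : R[i]) : scalar f -> (forall u, `|f u| <= M * `|u|) ->
  exists w, forall u, f u = inner u w.
Proof.
move=> flin fM; pose g u := complex.Re (f u).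
have fD u v : f (u + v) = f u + f v by have := flin 1 u v; rewrite scale1r mul1r.
have f0 : f 0 = 0 by apply: (addIr (f 0)); rewrite -fD !add0r.
have fZ c u : f (c *: u) = c * f u by have := flin c u 0; rewrite !addr0 f0 addr0.
suff [w gw] : exists w, forall u, g u = p u w.
  exists w => u; move: (gw u) (gw ('i *: u)).
  rewrite /g /p innerZl fZ !ReMi; case: (f u) => a b; case: (inner u w) => c d /=.
  by move=> -> /oppr_inj ->.
have [m m0 gm] : exists2 m, 0 <= m & forall u, `|g u| <= m * nr u.
  exists (complex.Re `|M|) => [|u]; first by rewrite -ler_rc -ge0_rc; exact: normr_ge0.
  rewrite -ler_rc; apply: (le_trans (Re_le_norm _)).
  rewrite rcM -nrE -ge0_rc //.
  have : `|f u| <= `|M * `|u| | by apply: le_trans (fM u) _; rewrite real_ler_norm // -?ler_norm ?ger0_real // (le_trans _ (fM u)).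
  by rewrite normrM normr_id.
have gD u v : g (u + v) = g u + g v by rewrite /g fD ReD.
have gZ t u : g (rc t *: u) = t * g u by rewrite /g fZ ReMl.
pose J u := nr u ^+ 2 - 2 * g u.
have Jexp t u v : J (u + rc t *: v) = J u + 2 * t * (p v u - g v) + t ^+ 2 * nr v ^+ 2.
  by rewrite /J pexp gD gZ; ring.
have Jlb u : - m ^+ 2 <= J u.
  have := gm u; rewrite ler_norml => /andP[_ gu].
  rewrite /J; have := sqr_ge0 (nr u - m); nra.
pose A := range J; have A_inf : has_inf A.
  by split; [exists (J 0), 0|exists (- m ^+ 2) => _ [u _ <-]].
pose d := inf A.
have dJ u : d <= J u by apply: ge_inf; [exact: A_inf.2|exists u].
have par u v : nr (u - v) ^+ 2 = 2 * J u + 2 * J v - 4 * J (u + rc 2^-1 *: (v - u)).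
  have -> : u - v = rc (-1) *: (v - u) by rewrite rmorphN1 scaleN1r opprB.
  set w := v - u; have -> : v = u + rc 1 *: w by rewrite rmorph1 scale1r addrC subrK.
  by rewrite !Jexp -!pnr pZl pC pZl pnr; field.
pose S e := [set u | J u < d + e].
have S_n0 e : 0 < e -> exists u, S e u.
  move=> e0; have [x Ax h] := inf_adherent e0 A_inf; by case: Ax h => y _ <- h; exists y.
pose F := filter_from [set e : R | 0 < e] S.
have FF : ProperFilter F.
  apply: filter_from_proper => [|e /= /S_n0 //].
  apply: filter_from_filter; first by exists 1 => /=.
  move=> i j /= i0 j0; exists (Num.min i j) => /=; first by rewrite lt_min i0 j0.
  by move=> u; rewrite /S /= => h; split; apply: (lt_le_trans h);
    rewrite lerD2l ge_min lexx ?orbT.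
have Fc : cauchy F.
  apply: cauchy_exP => e e0.
  have [e' ee] : exists e', e = rc e' by exists (complex.Re e); apply/ge0_rc/ltW.
  move: e0; rewrite ee ltr_rc => e0.
  have s0 : 0 < e' ^+ 2 / 4 by rewrite divr_gt0 ?exprn_gt0.
  have [u Su] := S_n0 _ s0; exists u, (e' ^+ 2 / 4) => //= v Sv.
  rewrite -ball_normE /= nrE ltr_rc -(@ltr_pXn2r _ 2) ?nnegrE ?(ltW e0) //.
  rewrite par; move: Su Sv (dJ (u + rc 2^-1 *: (v - u))); rewrite /S /=; lra.
have Fw : F --> lim F := cauchy_cvg F Fc.
set w := lim F in Fw.
exists w => u.
apply/eqP; rewrite -subr_eq0 -normr_eq0; apply/eqP/le_anti; rewrite normr_ge0 andbT.
apply/ler_addgt0Pl => e e0; rewrite addr0.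
pose del := e / (2 * (1 + nr u)).
have n1 : 0 < 1 + nr u by rewrite (lt_le_trans ltr01) ?lerDl.
have del0 : 0 < del by rewrite divr_gt0 // mulr_gt0.
have Fb : F (ball w (rc del)) by apply/Fw/nbhsx_ballx; rewrite ltr_rc.
have d20 : 0 < del ^+ 2 by rewrite exprn_gt0.
have FS : F (S (del ^+ 2)) by exists (del ^+ 2).
have [v [vb vS]] := @filter_ex _ F _ _ (filterI Fb FS).
move: vb; rewrite -ball_normE /= nrE ltr_rc => vb.
have h1 : (p u v - g u) ^+ 2 <= nr u ^+ 2 * (del ^+ 2).
  apply: quad => [|t]; first exact: sqr_ge0.
  by move: (dJ (v + rc t *: u)); rewrite Jexp; move: vS; rewrite /S /=; lra.
have h2 : `|p u v - g u| <= nr u * del.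
  rewrite -(@ler_pXn2r _ 2) ?nnegrE ?(mulr_ge0 (nr_ge0 u) (ltW del0)) //.
  by rewrite real_normK ?num_real // exprMn.
have h3 : `|p u w - p u v| <= nr u * del.
  have -> : p u w - p u v = p u (w - v) by rewrite (pC u (_ - _)) pDl pNl !(pC u).
  by apply: (le_trans (cs _ _)); rewrite ler_wpM2l ?(ltW vb).
have -> : g u - p u w = - ((p u w - p u v) + (p u v - g u)) by ring.
rewrite normrN (le_trans (ler_normD _ _)) //.
have : e = 2 * (1 + nr u) * del by rewrite /del; field; rewrite gt_eqF.
move: h2 h3 (nr_ge0 u) del0; nra.
Qed.

Lemma cauchy_schwarz u v : `|inner u v| <= `|u| * `|v|.
Proof.
have [z0|z_n0] := eqVneq (inner u v) 0; first by rewrite z0 normr0 mulr_ge0.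
pose s := (inner u v)^* / `|inner u v|.
have n0 : `|inner u v| != 0 by rewrite normr_eq0.
have ns : `|s| = 1 by rewrite normrM norm_conjC normfV normr_id divff.
have : `|inner u v| = inner (s *: u) v.
  rewrite innerZl /s mulrAC [_^* * _]mulrC -normCK expr2 -mulrA divff // mulr1 //.
move=> E; rewrite -[X in X <= _]ger0_norm // {1}E.
have := cs (s *: u) v; rewrite -ler_rc rcM -!nrE normrZ ns mul1r.
apply: le_trans; rewrite /p -E normr_id; rewrite [X in X <= _]ge0_rc // ler_rc.
exact: ler_norm.
Qed.

End Riesz.

Definition opnorm_le (R : realType) (G H : hilbertType R) (f : G -> H) M :=
  0 <= M /\ forall u, `|f u| <= M * `|u|.

Definition bounded_linear (R : realType) (G H : hilbertType R) (f : G -> H) :=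
  linear f /\ exists M, opnorm_le f M.

Definition bounded_linear_pred (R : realType) (G H : hilbertType R) :
  {pred G -> H} := [pred f | `[< bounded_linear f >]].
Arguments bounded_linear_pred {R} G H.

Record bop (R : realType) (G H : hilbertType R) := Bop {
  bop_fun :> G -> H;
  bopP : bop_fun \in bounded_linear_pred G H }.
Arguments bop {R} G H.

Section BopStructure.
Context {R : realType} {G H : hilbertType R}.

HB.instance Definition _ := [isSub for @bop_fun R G H].
HB.instance Definition _ := gen_eqMixin (bop G H).
HB.instance Definition _ := gen_choiceMixin (bop G H).

Lemma opnorm_leD (f g : G -> H) M N :
  opnorm_le f M -> opnorm_le g N -> opnorm_le (f + g) (M + N).
Proof.
move=> [M0 fM] [N0 gN]; split=> [|u]; first exact: addr_ge0.
by rewrite fctE mulrDl (le_trans (ler_normD _ _)) // lerD.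
Qed.

Lemma opnorm_leZ c (f : G -> H) M :
  opnorm_le f M -> opnorm_le (c *: f) (`|c| * M).
Proof.
move=> [M0 fM]; split=> [|u]; first exact: mulr_ge0.
by rewrite fctE normrZ -mulrA ler_wpM2l.
Qed.

Lemma bounded_linear_closed : submod_closed (bounded_linear_pred G H).
Proof.
split=> [|c f g /asboolP[fl [M fM]] /asboolP[gl [N gN]]].
  apply/asboolP; split=> [c u v|]; first by rewrite /= scaler0 addr0.
  by exists 0; split=> // u; rewrite normr0 mul0r.
apply/asboolP; split=> [d u v|].
  rewrite !fctE fl gl !scalerDr !scalerA (mulrC d) -!addrA; congr (_ + _).
  by rewrite addrCA.
by exists (`|c| * M + N); apply: opnorm_leD => //; apply: opnorm_leZ.
Qed.

HB.instance Definition _ :=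
  GRing.isSubmodClosed.Build _ _ (bounded_linear_pred G H) bounded_linear_closed.
HB.instance Definition _ := [SubChoice_isSubLmodule of bop G H by <:].

Lemma bop_linear (a : bop G H) : linear a.
Proof. by case: a => f /= /asboolP[]. Qed.

HB.instance Definition _ (a : bop G H) :=
  GRing.isLinear.Build _ _ _ _ a (bop_linear a).

Lemma bop_ext (a b : bop G H) : a =1 b -> a = b.
Proof. by move=> ab; apply/val_inj/funext. Qed.

End BopStructure.

Section BopAlgebra.
Context {R : realType}.
Implicit Types F G H : hilbertType R.

Lemma bop_bounded G H (a : bop G H) : exists M, opnorm_le a M.
Proof. by case: a => f /= /asboolP[]. Qed.

Fact bid_subproof H : (id : H -> H) \in bounded_linear_pred H H.
Proof.
by apply/asboolP; split=> //; exists 1; split=> // u; rewrite mul1r.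
Qed.
Definition bid H : bop H H := Bop (bid_subproof H).

Lemma opnorm_le_comp F G H (a : bop G H) (b : bop F G) M N :
  opnorm_le a M -> opnorm_le b N -> opnorm_le (a \o b) (M * N).
Proof.
move=> [M0 aM] [N0 bN]; split=> [|u]; first exact: mulr_ge0.
by apply: (le_trans (aM _)); rewrite -mulrA ler_wpM2l.
Qed.

Fact bcomp_subproof F G H (a : bop G H) (b : bop F G) :
  (a \o b) \in bounded_linear_pred F H.
Proof.
apply/asboolP; split=> [c u v|]; first by rewrite /= !linearP.
have [[M aM] [N bN]] := (bop_bounded a, bop_bounded b).
by exists (M * N); apply: opnorm_le_comp.
Qed.
Definition bcomp F G H (a : bop G H) (b : bop F G) : bop F H :=
  Bop (bcomp_subproof a b).

Lemma adjoint_exists G H (a : bop G H) :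
  exists b : bop H G, forall u v, inner (a u) v = inner u (b v).
Proof.
have [M [M0 aM]] := bop_bounded a.
have /choice[b ab] : forall v, exists w, forall u, inner (a u) v = inner u w.
  move=> v; apply: (@riesz _ _ _ (M * `|v|)) => [c u w|u].
    by rewrite linearP innerDl innerZl.
  apply: (le_trans (cauchy_schwarz _ _)); rewrite mulrAC ler_wpM2r //.
suff bP : b \in bounded_linear_pred H G by exists (Bop bP).
apply/asboolP; split=> [c u v|].
  by apply: inner_extr => w; rewrite innerDr innerZr -!ab innerDr innerZr.
exists M; split=> // v; have [->|bv0] := eqVneq `|b v| 0.
  by rewrite mulr_ge0.
have bv_gt0 : 0 < `|b v| by rewrite lt_def bv0 /=.
rewrite -(ler_pM2r bv_gt0) -expr2 -inner_norm -ab.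
rewrite -[X in X <= _]ger0_norm; last by rewrite ab inner_norm exprn_ge0.
apply: (le_trans (cauchy_schwarz _ _)).
by rewrite mulrAC ler_wpM2r.
Qed.

Definition adj G H (a : bop G H) : bop H G := projT1 (cid (adjoint_exists a)).

Lemma adjE G H (a : bop G H) u v : inner (a u) v = inner u (adj a v).
Proof. by rewrite /adj; case: cid. Qed.

Lemma adjEl G H (a : bop G H) u v : inner (adj a u) v = inner u (a v).
Proof. by rewrite inner_conj -adjE -inner_conj. Qed.

Lemma adjP G H (a : bop G H) (b : bop H G) :
  (forall u v, inner (a u) v = inner u (b v)) -> adj a = b.
Proof.
by move=> ab; apply: bop_ext => v; apply: inner_extr => u; rewrite -adjE.
Qed.

Lemma adjK G H (a : bop G H) : adj (adj a) = a.
Proof. by apply: adjP => u v; rewrite adjEl. Qed.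

Lemma adj_id H : adj (bid H) = bid H.
Proof. exact: adjP. Qed.

Lemma adjD G H (a b : bop G H) : adj (a + b) = adj a + adj b.
Proof.
by apply: adjP => u v; rewrite [LHS]innerDl [RHS]innerDr !adjE.
Qed.

Lemma adjZ G H (c : R[i]) (a : bop G H) : adj (c *: a) = c^* *: adj a.
Proof.
apply: adjP => u v; rewrite [LHS]innerZl [RHS]innerZr adjE.
by rewrite conjCK.
Qed.

Lemma adj_comp F G H (a : bop G H) (b : bop F G) :
  adj (bcomp a b) = bcomp (adj b) (adj a).
Proof. by apply: adjP => u v /=; rewrite !adjE. Qed.

Lemma opnorm_le_adj G H (a : bop G H) M : opnorm_le a M -> opnorm_le (adj a) M.
Proof.
move=> [M0 aM]; split=> // v; have [->|bv0] := eqVneq `|adj a v| 0.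
  by rewrite mulr_ge0.
have bv_gt0 : 0 < `|adj a v| by rewrite lt_def bv0 /=.
rewrite -(ler_pM2r bv_gt0) -expr2 -inner_norm -adjE.
rewrite -[X in X <= _]ger0_norm; last by rewrite adjE inner_norm exprn_ge0.
apply: (le_trans (cauchy_schwarz _ _)).
by rewrite mulrAC ler_wpM2r.
Qed.

Definition isometry G H (a : bop G H) := forall u, `|a u| = `|u|.

Definition unitary G H (a : bop G H) := isometry a /\ forall v, exists u, a u = v.

(* The predual of a dual Banach space [X] of operator-valued objects is the   *)
(* norm closure, inside the dual of [X], of the span of the vector            *)
(* functionals; [ball M] is the closed ball of radius [M] of [X].             *)
Definition predual (X : Type) (ball : R[i] -> set X) (vf : set (X -> R[i])) :
    set (X -> R[i]) :=
  [set phi | forall e, 0 < e -> exists m, exists2 f : 'I_m -> (X -> R[i]),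
    forall i, vf (f i) &
    forall M x, ball M x -> `|phi x - \sum_i f i x| <= e * M].

Definition weakstar_topology (X : choiceType) (P : set (X -> R[i])) :=
  sup_topology (fun phi : P =>
    Topological.on (initial_topology (set_val phi : X -> R[i]^o))).

HB.instance Definition _ (X : choiceType) (P : set (X -> R[i])) :=
  Topological.copy (weakstar_topology P)
    (sup_topology (fun phi : P =>
      Topological.on (initial_topology (set_val phi : X -> R[i]^o)))).

Definition bop_predual G H : set (bop G H -> R[i]) :=
  predual (fun M => [set a : bop G H | opnorm_le a M])
    [set f | exists u v, f = fun a : bop G H => inner (a u) v].

HB.instance Definition _ G H :=
  Topological.copy (bop G H) (weakstar_topology (@bop_predual G H)).

End BopAlgebra.

(* [mxsandwich a v b] is the product a v b of a matrix v over V with scalar   *)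
(* matrices a and b.                                                          *)
Definition mxsandwich (K : pzRingType) (V : lmodType K) (m k : nat)
    (a : 'M[K]_(m, k)) (v : 'M[V]_k) (b : 'M[K]_(k, m)) : 'M[V]_m :=
  \matrix_(i, j) \sum_p \sum_q (a i p * b q j) *: v p q.

Definition mx_opnorm_le (R : realType) (m k : nat) (a : 'M[R[i]]_(m, k)) M :=
  0 <= M /\ forall u : 'cV_k,
    \sum_i `|(a *m u) i ord0| ^+ 2 <= M ^+ 2 * \sum_j `|u j ord0| ^+ 2.

(* Operator spaces in the sense of Ruan's axioms.                             *)
HB.mixin Record isOperatorSpace (R : realType) V
    of CompleteNormedModule R[i] V := {
  mxnorm : forall k, 'M[V]_k -> R[i];
  mxnorm_ge0 : forall k (v : 'M[V]_k), 0 <= mxnorm k v;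
  mxnormD : forall k (v w : 'M[V]_k), 
    mxnorm k (v + w) <= mxnorm k v + mxnorm k w;
  mxnorm_scalar : forall v : V, mxnorm 1%N (const_mx v) = `|v|;
  mxnorm_block : forall k l (v : 'M[V]_k) (w : 'M[V]_l),
    mxnorm (k + l)%N (block_mx v 0 0 w) = Num.max (mxnorm k v) (mxnorm l w);
  mxnorm_sandwich : forall m k (a : 'M[R[i]]_(m, k)) (v : 'M[V]_k)
      (b : 'M[R[i]]_(k, m)) M N,
    mx_opnorm_le a M -> mx_opnorm_le b N ->
    mxnorm m (mxsandwich a v b) <= M * mxnorm k v * N }.
#[short(type="operatorSpaceType")]
HB.structure Definition OperatorSpace (R : realType) :=
  {V of isOperatorSpace R V & CompleteNormedModule R[i] V}.
Arguments mxnorm {R s} [k] v : rename.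

Definition cbnorm_le (R : realType) (V : operatorSpaceType R)
    (H : hilbertType R) (x : V -> bop H H) M :=
  0 <= M /\ forall k (v : 'M[V]_k) (u : 'I_k -> H),
    \sum_i `|\sum_j x (v i j) (u j)| ^+ 2 <=
    (M * mxnorm v) ^+ 2 * \sum_j `|u j| ^+ 2.

(* [cbmap V H] is CB(V, B(H)), i.e., M_n(E) for the dual operator space E     *)
(* with predual V, when n is the dimension of H.                              *)
Record cbmap (R : realType) (V : operatorSpaceType R) (H : hilbertType R) :=
  CbMap {
    cb_fun :> V -> bop H H;
    cb_linear : linear cb_fun;
    cb_bounded : exists M, cbnorm_le cb_fun M }.

HB.instance Definition _ (R : realType) V (H : hilbertType R) :=
  gen_eqMixin (@cbmap R V H).
HB.instance Definition _ (R : realType) V (H : hilbertType R) :=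
  gen_choiceMixin (@cbmap R V H).

Section CbMap.
Context {R : realType} {V : operatorSpaceType R}.
Implicit Types G H : hilbertType R.

Definition cbmap_predual H : set (cbmap V H -> R[i]) :=
  predual (fun M => [set x : cbmap V H | cbnorm_le x M])
    [set f | exists e u v, f = fun x : cbmap V H => inner (x e u) v].

HB.instance Definition _ H :=
  Topological.copy (cbmap V H) (weakstar_topology (@cbmap_predual H)).

Fact cb_compr_linear G H (a : bop G H) (x : cbmap V H) :
  linear (fun e => bcomp (adj a) (bcomp (x e) a)).
Proof.
move=> c e f; apply: bop_ext => u /=.
by rewrite (cb_linear x) /= [LHS]linearP.
Qed.

Lemma sum_opnorm_le G H (a : bop G H) M k (u : 'I_k -> G) : opnorm_le a M ->
  \sum_j `|a (u j)| ^+ 2 <= M ^+ 2 * \sum_j `|u j| ^+ 2.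
Proof.
move=> [M0 aM]; rewrite mulr_sumr; apply: ler_sum => i _.
by rewrite -exprMn lerXn2r ?nnegrE ?mulr_ge0.
Qed.

Lemma cbnorm_le_compr G H (a : bop G H) (x : cbmap V H) M N :
  opnorm_le a M -> cbnorm_le x N ->
  cbnorm_le (fun e => bcomp (adj a) (bcomp (x e) a)) (M * N * M).
Proof.
move=> aM [N0 xN]; have M0 := aM.1; split=> [|k v u]; first by rewrite !mulr_ge0.
under eq_bigr do rewrite -linear_sum.
apply: (le_trans (sum_opnorm_le _ (opnorm_le_adj aM))).
have -> : (M * N * M * mxnorm v) ^+ 2 * (\sum_j `|u j| ^+ 2) =
  M ^+ 2 * ((N * mxnorm v) ^+ 2 * (M ^+ 2 * \sum_j `|u j| ^+ 2)) by ring.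
rewrite ler_wpM2l ?exprn_ge0 //; apply: (le_trans (xN _ _ _)).
by rewrite ler_wpM2l ?exprn_ge0 ?mulr_ge0 ?mxnorm_ge0 // sum_opnorm_le.
Qed.

Fact cb_compr_bounded G H (a : bop G H) (x : cbmap V H) :
  exists M, cbnorm_le (fun e => bcomp (adj a) (bcomp (x e) a)) M.
Proof.
have [[M aM] [N xN]] := (bop_bounded a, cb_bounded x).
by exists (M * N * M); apply: cbnorm_le_compr.
Qed.

(* a^* x a *)
Definition cb_compr G H (a : bop G H) (x : cbmap V H) : cbmap V G :=
  CbMap (@cb_compr_linear _ _ a x) (@cb_compr_bounded _ _ a x).

End CbMap.

(* A nonzero cardinal at most the cardinality of [kappa], as a class of       *)
(* equipotent nonempty subsets of [kappa].                                    *)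
Record cardinal (kappa : Type) := Cardinal {
  card_class : set (set kappa);
  card_classP : exists2 A : set kappa,
    A !=set0 & card_class = [set B : set kappa | B #= A] }.

Definition orthonormal_basis (R : realType) (kappa : Type) (H : hilbertType R)
    (A : set kappa) (e : kappa -> H) :=
  (forall i j, A i -> A j -> inner (e i) (e j) = (`[< i = j >])%:R) /\
  (forall w, (forall i, A i -> inner (e i) w = 0) -> w = 0).

Definition has_dim (R : realType) (kappa : Type) (H : hilbertType R)
    (n : cardinal kappa) :=
  exists2 A, card_class n A & exists e, orthonormal_basis (H := H) A e.

Record hilbert_levels (R : realType) (kappa : Type) := HilbertLevels {
  hlevel :> cardinal kappa -> hilbertType R;
  hlevelP : forall n, has_dim (hlevel n) n }.

(* The ambient graded spaces, such as M(E), together with the operations and  *)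
(* relations entering nc convexity: [nball n c] is the closed ball of radius  *)
(* c at level n, [compr a x] is a^* x a, and [intertwines a x y] is the       *)
(* relation y a = a x.                                                        *)
Record ncspace (R : realType) (kappa : Type) (H : hilbert_levels R kappa) :=
  NcSpace {
    ncpoint :> cardinal kappa -> topologicalType;
    nball : forall n, R[i] -> set (ncpoint n);
    compr : forall m n, bop (H m) (H n) -> ncpoint n -> ncpoint m;
    intertwines : forall m n,
      bop (H m) (H n) -> ncpoint m -> ncpoint n -> Prop }.

Section NcConvex.
Context {R : realType} {kappa : Type} {H : hilbert_levels R kappa}.
Implicit Types X Y : ncspace H.

(* H n is the Hilbert space direct sum of the ranges of the isometries a i,   *)
(* i.e., \sum_i (a i) (a i)^* = 1.                                            *)
Definition hilbert_sum (I : Type) (d : I -> cardinal kappa) n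
    (a : forall i, bop (H (d i)) (H n)) :=
  [/\ forall i, isometry (a i),
      forall i j u v, i <> j -> inner (a i u) (a j v) = 0 &
      forall w, (forall i u, inner (a i u) w = 0) -> w = 0].

(* If [hilbert_sum a] then [is_dsum a x y] says that y is the direct sum      *)
(* \sum_i (a i) (x i) (a i)^*.                                                *)
Definition is_dsum X (I : Type) (d : I -> cardinal kappa) n
    (a : forall i, bop (H (d i)) (H n)) (x : forall i, X (d i)) (y : X n) :=
  forall i, intertwines (a i) (x i) y.

Definition norm_bounded X (I : Type) (d : I -> cardinal kappa)
    (x : forall i, X (d i)) :=
  exists c, forall i, nball c (x i).

Definition ncset X := forall n, set (X n).

Definition nc_convex X (K : ncset X) :=
  (forall (I : Type) (d : I -> cardinal kappa) n
      (a : forall i, bop (H (d i)) (H n)) (x : forall i, X (d i)) (y : X n),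
    hilbert_sum a -> norm_bounded x -> (forall i, K (d i) (x i)) ->
    is_dsum a x y -> K n y) /\
  (forall m n (a : bop (H m) (H n)) (x : X n),
    isometry a -> K n x -> K m (compr a x)).

Definition compact_nc_convex X (K : ncset X) :=
  [/\ nc_convex K, forall n, compact (K n) & exists n, K n !=set0].

Definition nc_function X Y (K : ncset X) (f : forall n, K n -> Y n) :=
  (forall (I : Type) (d : I -> cardinal kappa) n
      (a : forall i, bop (H (d i)) (H n)) (x : forall i, K (d i)) (y : K n),
    hilbert_sum a -> norm_bounded (fun i => set_val (x i)) ->
    is_dsum a (fun i => set_val (x i)) (set_val y) ->
    is_dsum a (fun i => f (d i) (x i)) (f n y)) /\
  (forall m n (a : bop (H m) (H n)) (x : K n) (y : K m),
    unitary a -> set_val y = compr a (set_val x) -> f m y = compr a (f n x)).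

Definition nc_affine X Y (K : ncset X) (f : forall n, K n -> Y n) :=
  nc_function f /\
  (forall m n (a : bop (H m) (H n)) (x : K n) (y : K m),
    isometry a -> set_val y = compr a (set_val x) -> f m y = compr a (f n x)).

(* M = M(C), with M_n(C) = B(H n) *)
Definition ncM : ncspace H := {|
  ncpoint n := bop (H n) (H n);
  nball n c := [set x : bop (H n) (H n) | opnorm_le x c];
  compr m n a x := bcomp (adj a) (bcomp x a);
  intertwines m n a x y := bcomp y a = bcomp a x |}.

(* M(E) for the dual operator space E with predual V *)
Definition ncME (V : operatorSpaceType R) : ncspace H := {|
  ncpoint n := cbmap V (H n);
  nball n c := [set x : cbmap V (H n) | cbnorm_le x c];
  compr m n a x := cb_compr a x;
  intertwines m n a x y := forall e, bcomp (y e) a = bcomp a (x e) |}.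

(* M(E1 x E2), with M_n(E1 x E2) identified with M_n(E1) x M_n(E2) *)
Definition ncprod X Y : ncspace H := {|
  ncpoint n := (X n * Y n)%type;
  nball n c := [set z | nball c z.1 /\ nball c z.2];
  compr m n a z := (compr a z.1, compr a z.2);
  intertwines m n a z w := intertwines a z.1 w.1 /\ intertwines a z.2 w.2 |}.

Definition prod_ncset X Y (K : ncset X) (L : ncset Y) : ncset (ncprod X Y) :=
  fun n => K n `*` L n.

End NcConvex.
Arguments ncM {R kappa} H.
Arguments ncME {R kappa} H V.

Section WeakStar.
Context {R : realType}.
Implicit Types G H : hilbertType R.

Lemma le0_arbitrary (z C : R[i]) :
  0 <= C -> (forall e, 0 < e -> `|z| <= e * C) -> z = 0.
Proof.
move=> C0 zC; apply/eqP; rewrite -normr_le0.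
apply/ler_addgt0Pl => e e0; rewrite addr0.
have C1 : 0 < C + 1 by rewrite ltr_wpDl.
apply: (le_trans (zC (e / (C + 1)) _)); first by rewrite divr_gt0.
by rewrite mulrAC ler_pdivrMr // ler_wpM2l ?(ltW e0) // lerDl.
Qed.

Lemma bop_predualP G H (phi : bop G H -> R[i]) : bop_predual phi -> scalar phi.
Proof.
move=> phiP c a b.
have [[M aM] [N bN]] := (bop_bounded a, bop_bounded b).
have cM := opnorm_leZ c aM; have sM := opnorm_leD cM bN.
have [[M0 _] [N0 _]] := (aM, bN).
pose C := (`|c| * M + N) + `|c| * M + N.
apply/eqP; rewrite -subr_eq0; apply/eqP; apply: (@le0_arbitrary _ C).
  by rewrite !addr_ge0 ?mulr_ge0.
move=> e e0; have [m [f fv fphi]] := phiP e e0.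
pose S x := \sum_i f i x.
have Slin : S (c *: a + b) = c * S a + S b.
  rewrite /S mulr_sumr -big_split; apply: eq_bigr => i _ /=.
  have [u [v ->]] := fv i; by rewrite [LHS]innerDl [X in X + _]innerZl.
have -> : phi (c *: a + b) - (c * phi a + phi b) =
  (phi (c *: a + b) - S (c *: a + b)) - c * (phi a - S a) - (phi b - S b).
  by rewrite Slin; ring.
apply: (le_trans (ler_normB _ _)); rewrite /C !(mulrDr e).
apply: lerD; last exact: fphi.
apply: (le_trans (ler_normB _ _)); apply: lerD.
  by rewrite -(mulrDr e); apply: fphi.
by rewrite normrM mulrCA ler_wpM2l //; apply: fphi.
Qed.

Lemma bop_predual_adj G H (phi : bop G H -> R[i]) :
  bop_predual phi -> bop_predual (fun a : bop H G => (phi (adj a))^*).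
Proof.
move=> phiP e e0; have [m [f fv fphi]] := phiP e e0.
exists m, (fun i a => (f i (adj a))^*) => [i|M a aM].
  have [u [v fuv]] := fv i; exists v, u; apply/funext => a.
  by rewrite fuv adjEl -inner_conj.
rewrite -rmorph_sum -rmorphB norm_conjC; apply: fphi.
exact: opnorm_le_adj.
Qed.

Lemma continuous_bopP G H (T : topologicalType) (f : T -> bop G H) :
  continuous f <-> forall phi : bop G H -> R[i], bop_predual phi ->
    continuous (phi \o f : T -> R[i]^o).
Proof.
split=> [cf phi phiP x|cf x].
  apply: continuous_comp; first exact: cf.
  have /cvg_sup/(_ (exist _ phi (mem_set phiP))) : nbhs (f x) --> f x by [].
  move=> h; apply: cvg_trans (@initial_continuous _ _ (phi : bop G H -> R[i]^o) (f x)).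
  exact: (cvg_app _ h).
apply/cvg_sup => phi.
have cphi := cf (set_val phi) (set_mem (valP phi)).
by have := @continuous_comp_initial _ _ _ (set_val phi : bop G H -> R[i]^o) f cphi x.
Qed.

Lemma continuous_bopD G H (T : topologicalType) (c : R[i]) (f g : T -> bop G H) :
  continuous f -> continuous g -> continuous (fun x => c *: f x + g x).
Proof.
move=> /continuous_bopP cf /continuous_bopP cg; apply/continuous_bopP => phi phiP.
have -> : phi \o (fun x => c *: f x + g x) =
    (fun x => c *: (phi (f x) : R[i]^o) + phi (g x)).
  by apply/funext => x /=; rewrite (bop_predualP phiP).
move=> x; apply: cvgD; last exact: cg.
by apply: cvgZl_tmp; exact: cf.
Qed.

Lemma continuous_bop_adj G H (T : topologicalType) (f : T -> bop G H) :
  continuous f -> continuous (fun x => adj (f x)).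
Proof.
move=> /continuous_bopP cf; apply/continuous_bopP => phi phiP.
have c := cf _ (bop_predual_adj phiP).
have -> : phi \o (fun x => adj (f x)) =
    (fun x => ((phi (adj (f x)))^* : R[i]^o)^* : R[i]^o).
  by apply/funext => x /=; rewrite conjCK.
move=> x; have /cvgrPdist_lt h := c x; apply/cvgrPdist_lt => e e0.
near=> y; rewrite -rmorphB norm_conjC /=.
by near: y; apply: h.
Unshelve. all: by end_near. Qed.

End WeakStar.

(* The data of an operator system: a *-vector space with a unit and positive  *)
(* cones in its matrix levels.                                                *)
Record opSystem (R : realType) := OpSystem {
  os_sort :> lmodType R[i];
  os_star : os_sort -> os_sort;
  os_one : os_sort;
  os_pos : forall k, set 'M[os_sort]_k;
  os_starP : forall c x y,
    os_star (c *: x + y) = c^* *: os_star x + os_star y;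
  os_starK : involutive os_star;
  os_star1 : os_star os_one = os_one }.
Arguments os_one {R} o.
Arguments os_pos {R o} [k] m.

Definition complete_order_iso (R : realType) (S T : opSystem R) (f : S -> T) :=
  [/\ linear f, bijective f, f (os_one S) = os_one T,
      forall x, f (os_star x) = os_star (f x) &
      forall k (m : 'M[S]_k), os_pos m <-> os_pos (map_mx f m)].

(* A matrix of operators on H is positive as an operator on H^k.              *)
Definition bopmx_pos (R : realType) (H : hilbertType R) k
    (m : 'M[bop H H]_k) :=
  forall u : 'I_k -> H, 0 <= \sum_i \sum_j inner (m i j (u j)) (u i).

Definition graded_fun (R : realType) (kappa : Type)
    (H : hilbert_levels R kappa) (X : ncspace H) (K : ncset X) :=
  forall n, K n -> ncM H n.

Section GradedFun.
Context {R : realType} {kappa : Type} {H : hilbert_levels R kappa}.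
Context {X : ncspace H} (K : ncset X).
Local Notation G := (graded_fun K).
Implicit Types f g h : G.

HB.instance Definition _ := gen_eqMixin G.
HB.instance Definition _ := gen_choiceMixin G.

Lemma graded_fun_ext f g : (forall n x, f n x = g n x) -> f = g.
Proof.
by move=> fg; apply: functional_extensionality_dep => n; apply/funext => x.
Qed.

Definition gf_add f g : G := fun n x => (f n x : bop (H n) (H n)) + g n x.
Definition gf_opp f : G := fun n x => - (f n x : bop (H n) (H n)).
Definition gf_zero : G := fun n x => (0 : bop (H n) (H n)).
Definition gf_scale (c : R[i]) f : G :=
  fun n x => c *: (f n x : bop (H n) (H n)).

Definition gf_one : G := fun n x => bid (H n).
Definition gf_star f : G := fun n x => adj (f n x : bop (H n) (H n)).

Fact gf_addA : associative gf_add.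
Proof. by move=> f g h; apply: graded_fun_ext => n x; exact: addrA. Qed.
Fact gf_addC : commutative gf_add.
Proof. by move=> f g; apply: graded_fun_ext => n x; exact: addrC. Qed.
Fact gf_add0 : left_id gf_zero gf_add.
Proof. by move=> f; apply: graded_fun_ext => n x; exact: add0r. Qed.
Fact gf_addN : left_inverse gf_zero gf_opp gf_add.
Proof. by move=> f; apply: graded_fun_ext => n x; exact: addNr. Qed.

HB.instance Definition _ :=
  GRing.isZmodule.Build G gf_addA gf_addC gf_add0 gf_addN.

Fact gf_scaleA c d f : gf_scale c (gf_scale d f) = gf_scale (c * d) f.
Proof. by apply: graded_fun_ext => n x; exact: scalerA. Qed.
Fact gf_scale1 : left_id 1 gf_scale.
Proof. by move=> f; apply: graded_fun_ext => n x; exact: scale1r. Qed.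
Fact gf_scaleDr : right_distributive gf_scale +%R.
Proof. by move=> c f g; apply: graded_fun_ext => n x; exact: scalerDr. Qed.
Fact gf_scaleDl f : {morph gf_scale^~ f : c d / c + d}.
Proof. by move=> c d; apply: graded_fun_ext => n x; exact: scalerDl. Qed.

HB.instance Definition _ := GRing.Zmodule_isLmodule.Build R[i] G
  gf_scaleA gf_scale1 gf_scaleDr gf_scaleDl.

Definition nc_affine_continuous : {pred G} :=
  [pred f | `[< nc_affine f /\ forall n, continuous (f n) >]].

Lemma bcompDr n m p (a : bop (H n) (H p)) (x y : bop (H m) (H n)) c :
  bcomp a (c *: x + y) = c *: bcomp a x + bcomp a y.
Proof. by apply: bop_ext => u; rewrite /= [LHS]linearP. Qed.

Lemma nc_affine_lin c f g : nc_affine f -> nc_affine g -> nc_affine (c *: f + g).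
Proof.
have compr_lin m n (a : bop (H m) (H n)) (x y : bop (H n) (H n)) :
    bcomp (adj a) (bcomp (c *: x + y) a) =
    c *: bcomp (adj a) (bcomp x a) + bcomp (adj a) (bcomp y a).
  by apply: bop_ext => u; rewrite /= [LHS]linearP.
move=> [[fs fu] fi] [[gs gu] gi]; split; first split.
- move=> I d n a x y aP xb xy i.
  have := fs I d n a x y aP xb xy i; have := gs I d n a x y aP xb xy i.
  rewrite /= => gE fE; rewrite bcompDr -fE -gE; exact: bop_ext.
- move=> m n a x y aP yx.
  by rewrite [LHS]/(c *: (f m y : bop _ _) + g m y) (fu _ _ _ _ _ aP yx)
    (gu _ _ _ _ _ aP yx); exact/esym/compr_lin.
- move=> m n a x y aP yx.
  by rewrite [LHS]/(c *: (f m y : bop _ _) + g m y) (fi _ _ _ _ _ aP yx)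
    (gi _ _ _ _ _ aP yx); exact/esym/compr_lin.
Qed.

Lemma isometry_inner (H1 H2 : hilbertType R) (a : bop H1 H2) u v :
  isometry a -> inner (a u) (a v) = inner u v.
Proof.
move=> aI; pose q u v := inner (a u) (a v) - inner u v.
have q0 w : q w w = 0 by rewrite /q !inner_norm aI subrr.
have qD : q u v + q v u = 0.
  have := q0 (u + v); rewrite /q linearD !(innerDl, innerDr) => <-.
  have := q0 u; have := q0 v; rewrite /q => /eqP; rewrite subr_eq0 => /eqP ->.
  by move=> /eqP; rewrite subr_eq0 => /eqP ->; ring.
have qi : q u v = q v u.
  have := q0 (u + 'i *: v); rewrite /q linearD linearZ.
  rewrite !(innerDl, innerDr, innerZl, innerZr) conjCi => E.
  have := q0 u; have := q0 v; rewrite /q => /eqP; rewrite subr_eq0 => /eqP vv.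
  move=> /eqP; rewrite subr_eq0 => /eqP uu; move: E; rewrite vv uu => E.
  apply: (mulfI (neq0Ci _)); apply/eqP; rewrite -subr_eq0 -oppr_eq0.
  by rewrite -E; apply/eqP; ring.
apply/eqP; rewrite -subr_eq0 -/(q u v).
by move: qD; rewrite -qi -mulr2n -mulr_natl => /eqP; rewrite mulf_eq0 pnatr_eq0.
Qed.

Lemma hilbert_sum_adj (I : Type) (d : I -> cardinal kappa) n
    (a : forall i, bop (H (d i)) (H n)) (x : forall i, bop (H (d i)) (H (d i)))
    (y : bop (H n) (H n)) : hilbert_sum a ->
  (forall i, bcomp y (a i) = bcomp (a i) (x i)) ->
  forall i, bcomp (adj y) (a i) = bcomp (a i) (adj (x i)).
Proof.
move=> [aI aO aT] yx i; apply: bop_ext => u /=.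
apply/eqP; rewrite -subr_eq0; apply/eqP/aT => j v.
rewrite innerDr innerNr -adjE.
have -> : y (a j v) = a j (x j v) by have /(congr1 (fun b => bop_fun b v)) := yx j.
have [ij|ij] := pselect (j = i); last by rewrite !aO // subrr.
subst j.
by rewrite !(isometry_inner _ _ (aI i)) adjE subrr.
Qed.

Lemma nc_affine_adj f :
  nc_affine f -> nc_affine (gf_star f).
Proof.
move=> [[fs fu] fi]; split; first split.
- move=> I d n a x y aP xb xy; exact: (hilbert_sum_adj aP (fs _ _ _ _ _ _ aP xb xy)).
- move=> m n a x y aP yx.
  by rewrite /gf_star (fu _ _ _ _ _ aP yx) /= !adj_comp adjK; apply: bop_ext.
- move=> m n a x y aP yx.
  by rewrite /gf_star (fi _ _ _ _ _ aP yx) /= !adj_comp adjK; apply: bop_ext.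
Qed.

Lemma nc_affine_one : nc_affine gf_one.
Proof.
have compr1 m n (a : bop (H m) (H n)) : isometry a ->
    bid (H m) = bcomp (adj a) (bcomp (bid (H n)) a).
  move=> aI; apply: bop_ext => u /=; apply: inner_ext => v.
  by rewrite adjEl isometry_inner.
split; first split.
- by move=> I d n a x y _ _ _ i; apply: bop_ext.
- by move=> m n a x y [aI _] _; exact: compr1.
- by move=> m n a x y aI _; exact: compr1.
Qed.

Lemma nc_affine0 : nc_affine (0 : G).
Proof.
have -> : (0 : G) = -1 *: gf_one + gf_one.
  by rewrite scaleN1r addNr.
exact: (nc_affine_lin (-1) nc_affine_one nc_affine_one).
Qed.

Lemma nc_affine_continuous_closed : submod_closed nc_affine_continuous.
Proof.
split=> [|c f g /asboolP[fa fc] /asboolP[ga gc]]; apply/asboolP; split.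
- exact: nc_affine0.
- by move=> n; exact: cst_continuous.
- exact: nc_affine_lin.
- by move=> n; exact: (continuous_bopD (fc n) (gc n)).
Qed.

HB.instance Definition _ :=
  GRing.isSubmodClosed.Build _ _ nc_affine_continuous nc_affine_continuous_closed.

(* The elements of A(K): continuous nc affine functions from K to M           *)
Record ncA := NcA {
  ncA_fun : G;
  ncAP : ncA_fun \in nc_affine_continuous }.

Definition ncA_eval (a : ncA) : forall n, @K n -> bop (H n) (H n) := ncA_fun a.
Coercion ncA_eval : ncA >-> Funclass.

HB.instance Definition _ := [isSub for ncA_fun].
HB.instance Definition _ := gen_eqMixin ncA.
HB.instance Definition _ := gen_choiceMixin ncA.
HB.instance Definition _ := [SubChoice_isSubLmodule of ncA by <:].

Fact ncA_one_subproof : gf_one \in nc_affine_continuous.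
Proof.
apply/asboolP; split; first exact: nc_affine_one.
by move=> n; exact: cst_continuous.
Qed.

Fact ncA_star_subproof (a : ncA) : gf_star (ncA_fun a) \in nc_affine_continuous.
Proof.
have /asboolP[aa ac] := ncAP a; apply/asboolP; split.
  exact: nc_affine_adj.
by move=> n; exact: (continuous_bop_adj (ac n)).
Qed.

Definition ncA_one : ncA := NcA ncA_one_subproof.
Definition ncA_star (a : ncA) : ncA := NcA (ncA_star_subproof a).

Definition ncA_pos k : set 'M[ncA]_k :=
  [set m | forall n x, bopmx_pos (map_mx (fun a : ncA => a n x) m)].

Fact ncA_starP c (a b : ncA) :
  ncA_star (c *: a + b) = c^* *: ncA_star a + ncA_star b.
Proof.
apply/val_inj/graded_fun_ext => n x /=.
by rewrite /gf_star [X in adj X]/(c *: a n x + b n x) adjD adjZ.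
Qed.

Fact ncA_starK : involutive ncA_star.
Proof. by move=> a; apply/val_inj/graded_fun_ext => n x; exact: adjK. Qed.

Fact ncA_star1 : ncA_star ncA_one = ncA_one.
Proof. by apply/val_inj/graded_fun_ext => n x; exact: adj_id. Qed.

Definition ncA_opSystem : opSystem R :=
  OpSystem ncA_pos ncA_starP ncA_starK ncA_star1.

End GradedFun.

Section UnitalSum.
Context {R : realType} (S T : opSystem R).

(* S (+)_1 T is the quotient (S x T) / C((1, 0) - (0, 1)).                    *)
Definition usum_kernel : {pred S * T} :=
  [pred p | `[< exists c : R[i], p = c *: (os_one S, - os_one T) >]].

Fact usum_kernel_closed : submod_closed usum_kernel.
Proof.
split=> [|c p q /asboolP[d ->] /asboolP[e ->]]; apply/asboolP.
  by exists 0; rewrite scale0r.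
by exists (c * d + e); rewrite scalerDl scalerA.
Qed.

HB.instance Definition _ :=
  GRing.isSubmodClosed.Build _ _ usum_kernel usum_kernel_closed.

Definition usum : Type := Quotient.quot usum_kernel.
HB.instance Definition _ := GRing.Zmodule.on usum.

Definition usum_class (s : S) (t : T) : usum := \pi_(Quotient.quot usum_kernel)%qT (s, t).

Fact usum_classP (z : usum) : exists s t, z = usum_class s t.
Proof.
by exists (repr z).1, (repr z).2; rewrite /usum_class -surjective_pairing reprK.
Qed.

Lemma usum_class_eq s t s' t' : usum_class s t = usum_class s' t' <->
  exists c : R[i], s - s' = c *: os_one S /\ t - t' = - (c *: os_one T).
Proof.
split=> [/eqP|[c [sE tE]]].
  rewrite /usum_class -Quotient.idealrBE => /asboolP[c [-> ->]].
  by exists c; rewrite scalerN.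
apply/eqP; rewrite -Quotient.idealrBE; apply/asboolP; exists c.
by congr pair; rewrite //= tE scalerN.
Qed.

Lemma usum_classD s t s' t' :
  usum_class s t + usum_class s' t' = usum_class (s + s') (t + t').
Proof. exact/esym/(Quotient.pi_add _ (s, t) (s', t')). Qed.

Definition usum_scale (c : R[i]) (z : usum) : usum :=
  usum_class (c *: (repr z).1) (c *: (repr z).2).

Definition usum_star (z : usum) : usum :=
  usum_class (os_star (repr z).1) (os_star (repr z).2).

Lemma usum_reprP s t : exists c : R[i],
  (repr (usum_class s t)).1 - s = c *: os_one S /\
  (repr (usum_class s t)).2 - t = - (c *: os_one T).
Proof.
by apply/usum_class_eq; rewrite /usum_class -surjective_pairing reprK.
Qed.

Lemma usum_scaleE c s t :
  usum_scale c (usum_class s t) = usum_class (c *: s) (c *: t).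
Proof.
have [d [sE tE]] := usum_reprP s t; apply/usum_class_eq; exists (c * d).
by rewrite -!scalerBr sE tE scalerN !scalerA.
Qed.

Lemma os_starB (Z : opSystem R) (x y : Z) :
  os_star (x - y) = os_star x - os_star y.
Proof.
by have := os_starP (-1) y x; rewrite !scaleN1r rmorphN1 scaleN1r addrC => ->;
  rewrite addrC.
Qed.

Lemma os_star0 (Z : opSystem R) : os_star (0 : Z) = 0.
Proof. by have := os_starB (0 : Z) 0; rewrite !subrr. Qed.

Lemma os_starZ (Z : opSystem R) c (x : Z) : os_star (c *: x) = c^* *: os_star x.
Proof. by have := os_starP c x 0; rewrite os_star0 !addr0. Qed.

Lemma usum_starE s t :
  usum_star (usum_class s t) = usum_class (os_star s) (os_star t).
Proof.
have [d [sE tE]] := usum_reprP s t; apply/usum_class_eq; exists d^*.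
by rewrite -!os_starB sE tE -scaleNr !os_starZ !os_star1 rmorphN scaleNr.
Qed.

Fact usum_scaleA c d z : usum_scale c (usum_scale d z) = usum_scale (c * d) z.
Proof.
by have [s [t ->]] := usum_classP z; rewrite !usum_scaleE !scalerA.
Qed.

Fact usum_scale1 : left_id 1 usum_scale.
Proof.
by move=> z; have [s [t ->]] := usum_classP z; rewrite usum_scaleE !scale1r.
Qed.

Fact usum_scaleDr : right_distributive usum_scale +%R.
Proof.
move=> c z w; have [s [t ->]] := usum_classP z; have [u [v ->]] := usum_classP w.
by rewrite usum_classD !usum_scaleE usum_classD !scalerDr.
Qed.

Fact usum_scaleDl z : {morph usum_scale^~ z : c d / c + d}.
Proof.
move=> c d; have [s [t ->]] := usum_classP z.
by rewrite !usum_scaleE usum_classD !scalerDl.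
Qed.

HB.instance Definition _ := GRing.Zmodule_isLmodule.Build R[i] usum
  usum_scaleA usum_scale1 usum_scaleDr usum_scaleDl.

Lemma usum_classZ c s t : c *: usum_class s t = usum_class (c *: s) (c *: t).
Proof. exact: usum_scaleE. Qed.

(* lambda (x) 1_Z *)
Definition scalar_mx_of (Z : opSystem R) k (l : 'M[R[i]]_k) : 'M[Z]_k :=
  map_mx (fun c => c *: os_one Z) l.

(* Passing to another representative (s, t) only shifts l, so positivity does *)
(* not depend on the representative.                                          *)
Definition usum_pos k : set 'M[usum]_k :=
  [set z | exists (s : 'M[S]_k) (t : 'M[T]_k),
    z = \matrix_(i, j) usum_class (s i j) (t i j) /\
    exists l : 'M[R[i]]_k,
      os_pos (s - scalar_mx_of S l) /\ os_pos (t + scalar_mx_of T l)].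

Fact usum_starP c (z w : usum) :
  usum_star (c *: z + w) = c^* *: usum_star z + usum_star w.
Proof.
have [s [t ->]] := usum_classP z; have [u [v ->]] := usum_classP w.
by rewrite usum_classZ usum_classD !usum_starE usum_classZ usum_classD !os_starP.
Qed.

Fact usum_starK : involutive usum_star.
Proof.
by move=> z; have [s [t ->]] := usum_classP z; rewrite !usum_starE !os_starK.
Qed.

Fact usum_star1 : usum_star (usum_class (os_one S) 0) = usum_class (os_one S) 0.
Proof. by rewrite usum_starE os_star1 os_star0. Qed.

Definition usum_opSystem : opSystem R :=
  OpSystem usum_pos usum_starP usum_starK usum_star1.

End UnitalSum.

(* Main.v *)
Require Import Defs.
From mathcomp Require Import all_boot all_order all_algebra.
From mathcomp Require Import complex.
From mathcomp Require Import all_classical reals topology normedtype.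
From mathcomp Require Import ring lra.
Import Order.TTheory GRing.Theory Num.Theory.
Import numFieldNormedType.Exports.
Import Defs.
Local Open Scope classical_set_scope.
Local Open Scope ring_scope.
Local Open Scope card_scope.
Set Implicit Arguments.
Unset Strict Implicit.
Unset Printing Implicit Defensive.

(** The map sends the class of (a, b) to (x, y) |-> a(x) + b(y); it kills
    (1, 0) - (0, 1) and preserves the unit and the involution.  Two facts make
    it an isomorphism and a third makes it a complete order isomorphism.

    Everything on the level of functions is decided at level one.  For a unit
    vector u, seen as an isometry from a line into H_n, nc affinity gives
    <f(x) u, u> = f(u^* x u), and an operator is determined by these numbers;
    so an element of A(K) is determined by its values on K(1)
    ([ncA_ext_line]).  It also matters that K contains scalar points: a point
    x0 of K(1) gives the multiples x0 I_n, one at each level, because H_n is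
    a direct sum of lines ([scalar_point_mem]).  They are compatible with
    compressions and direct sums, so they serve as constants.

    Injectivity ([ncA_sum_eq0]): if a(x) + b(y) = 0 for all x and y, fixing y
    shows that a is constant on K1(1), hence a multiple of 1.

    Surjectivity ([ncA_sum_surj]): for f in A(K1 x K2) take
    a(x) = f(x, y0) and b(y) = f(x0, y) - f(x0, y0).  That f = a + b is at level
    one the identity f(x, y) + f(x0, y0) = f(x, y0) + f(x0, y)
    ([ncA_exchange]): the points (x (+) x0, y (+) y0) and (x (+) x0, y0 (+) y)
    of level two have the same compression to the line of (1, 1).

    Order ([positive_sandwich]): let a and b be k by k matrices over A(K1) and
    A(K2).  For vectors u_1, ..., u_k of H_n with Gram matrix G put
    a(x)[u] = sum_ij <a_ij(x) u_j, u_i>; a scalar matrix l contributes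
    <l, G> = sum_ij l_ij G_ij.  Wanted is l with a(x)[u] >= <l, G(u)> and
    b(y)[v] >= - <l, G(v)> for all x, y, u, v.  Thus l is a linear functional
    squeezed between two functions of G: the infimum p of a(x)[u] over the
    pairs (x, u) with Gram matrix G, and -q, where q is the same for b.  Direct
    sums add Gram matrices, so p and q are sublinear.  Systems u and v with
    the same Gram matrix come from one system in a common finite-dimensional
    level ([gram_matching], by Gram-Schmidt), and compressing x and y to it
    turns positivity of a(x) + b(y) there into p + q >= 0.  So the Hahn-Banach
    sandwich theorem applies.  As only finitely many matrix entries are
    involved, it is proved by choosing one coordinate of the functional at a
    time ([cone_functional]).  The values a(x)[u] may be complex; the theorem
    is applied once to the real and once to the imaginary parts. *)

(** * Finite orthonormal systems in Hilbert spaces *)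

Section HilbertSpace.
Context {R : realType}.
Implicit Types G H : hilbertType R.

Lemma inner0r H (u : H) : inner u 0 = 0.
Proof. by rewrite inner_conj inner0l rmorph0. Qed.

Lemma inner_suml H (I : finType) (f : I -> H) v :
  inner (\sum_i f i) v = \sum_i inner (f i) v.
Proof.
elim/big_rec2: _ => [|i x y _ <-]; first exact: inner0l.
exact: innerDl.
Qed.

Lemma inner_sumr H (I : finType) (f : I -> H) v :
  inner v (\sum_i f i) = \sum_i inner v (f i).
Proof.
elim/big_rec2: _ => [|i x y _ <-]; first exact: inner0r.
exact: innerDr.
Qed.

Lemma inner_eq0 H (u : H) : inner u u = 0 -> u = 0.
Proof.
by rewrite inner_norm => /eqP; rewrite sqrf_eq0 normr_eq0 => /eqP.
Qed.

Lemma norm_of_inner G H (u : G) (v : H) :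
  inner u u = inner v v -> `|u| = `|v|.
Proof.
by rewrite !inner_norm => /eqP; rewrite eqrXn2 // => /eqP.
Qed.

Lemma conj_normV H (u : H) : (`|u|^-1)^* = `|u|^-1 :> R[i].
Proof. by apply: CrealP; rewrite ger0_real // invr_ge0. Qed.

Lemma unit_vector H (u : H) : u != 0 -> inner (`|u|^-1 *: u) (`|u|^-1 *: u) = 1.
Proof.
move=> u0; have n0 : `|u| != 0 by rewrite normr_eq0.
by rewrite innerZl innerZr inner_norm conj_normV; field.
Qed.

(** Polarization: u + v and u + i v separate the two cross terms. *)
Lemma bop_quad_eq0 H (T : bop H H) : (forall u, inner (T u) u = 0) -> T = 0.
Proof.
move=> q0; apply: bop_ext => u; apply: inner_ext => v.
have E1 : inner (T u) v + inner (T v) u = 0.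
  by rewrite -[RHS](q0 (u + v)) linearD !(innerDl, innerDr) !q0; ring.
have E2 : inner (T u) v - inner (T v) u = 0.
  have : 'i * (inner (T u) v - inner (T v) u) = 0.
    rewrite -[RHS](oppr0) -[in RHS](q0 (u + 'i *: v)) linearD linearZ.
    by rewrite !(innerDl, innerDr, innerZl, innerZr) !q0 conjCi; ring.
  by move/eqP; rewrite mulf_eq0 (negbTE (neq0Ci _)) => /eqP.
rewrite inner0l; apply: (@mulfI _ 2); first by rewrite pnatr_eq0.
by rewrite mulr0 -[RHS](addr0 0) -{1}E1 -E2; ring.
Qed.

Lemma bop_quad_unit_eq0 H (T : bop H H) :
  (forall u, inner u u = 1 -> inner (T u) u = 0) -> T = 0.
Proof.
move=> q1; apply: bop_quad_eq0 => u.
have [->|u0] := eqVneq u 0; first by rewrite inner0r.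
have n0 : `|u| != 0 by rewrite normr_eq0.
have -> : u = `|u| *: (`|u|^-1 *: u) by rewrite scalerA divff // scale1r.
by rewrite linearZ /= innerZl innerZr q1 ?mulr0 // unit_vector.
Qed.

Definition orthonormal_family H m (w : 'I_m -> H) :=
  forall i j, inner (w i) (w j) = (i == j)%:R.

Definition hilbert_basis H m (b : 'I_m -> H) :=
  orthonormal_family b /\ forall v, (forall i, inner (b i) v = 0) -> v = 0.

Lemma inner_coord H m (w : 'I_m -> H) (c : 'I_m -> R[i]) j :
  orthonormal_family w -> inner (\sum_i c i *: w i) (w j) = c j.
Proof.
move=> wO; rewrite inner_suml (bigD1 j) //= innerZl wO eqxx mulr1.
rewrite big1 ?addr0 // => i ij; by rewrite innerZl wO (negbTE ij) mulr0.
Qed.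

Lemma inner_orthonormal H m (w : 'I_m -> H) (c d : 'I_m -> R[i]) :
  orthonormal_family w ->
  inner (\sum_i c i *: w i) (\sum_i d i *: w i) = \sum_i c i * (d i)^*.
Proof.
move=> wO; rewrite inner_sumr; apply: eq_bigr => j _.
by rewrite innerZr inner_coord // mulrC.
Qed.

Lemma basis_expansion H m (b : 'I_m -> H) v :
  hilbert_basis b -> v = \sum_i inner v (b i) *: b i.
Proof.
move=> [bO bT]; apply/eqP; rewrite -subr_eq0; apply/eqP/bT => i.
rewrite inner_conj innerDl innerNl inner_coord // subrr.
exact: rmorph0.
Qed.

Lemma orthonormal_isometry G H m (b : 'I_m -> G) (w : 'I_m -> H) :
  hilbert_basis b -> orthonormal_family w ->
  exists2 a : bop G H, isometry a & forall i, a (b i) = w i.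
Proof.
move=> bB wO; pose f v := \sum_i inner v (b i) *: w i.
have fN v : `|f v| = `|v|.
  apply: norm_of_inner; rewrite [in RHS](basis_expansion v bB) /f.
  by rewrite !inner_orthonormal //; exact: bB.1.
have fP : f \in bounded_linear_pred G H.
  apply/asboolP; split=> [c u v|].
    rewrite /f scaler_sumr -big_split; apply: eq_bigr => i _ /=.
    by rewrite innerDl innerZl scalerDl scalerA.
  by exists 1; split=> // u; rewrite mul1r fN.
exists (Bop fP) => //= i; rewrite /f (bigD1 i) //= bB.1 eqxx scale1r.
rewrite big1 ?addr0 // => j ji.
by rewrite bB.1 eq_sym (negbTE ji) scale0r.
Qed.

(** That the w_i are in turn combinations of the u_j is what makes the whole
    construction a matter of the Gram matrix of u, see [gram_matching].  Linear
    dependence among the u_j is allowed; then m < k. *)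
Lemma gram_schmidt H k (u : 'I_k -> H) :
  exists m (w : 'I_m -> H),
  [/\ orthonormal_family w,
      forall i, exists c : 'I_k -> R[i], w i = \sum_j c j *: u j &
      forall j, u j = \sum_i inner (u j) (w i) *: w i].
Proof.
elim: k u => [|k IH] u.
  by exists 0%N, (fun _ => 0); split=> [i|i|i]; case: i.
have [m [w [wO wu uw]]] := IH (fun j => u (lift ord0 j)).
pose r := u ord0 - \sum_i inner (u ord0) (w i) *: w i.
have rw i : inner r (w i) = 0 by rewrite /r innerDl innerNl inner_coord // subrr.
have [c wE] := choice wu.
have rE : r = \sum_j oapp (fun j => - \sum_i inner (u ord0) (w i) * c i j) 1
                       (unlift ord0 j) *: u j.
  rewrite big_ord_recl unlift_none /= scale1r /r; congr (_ + _).
  under [RHS]eq_bigr do rewrite liftK /= scaleNr scaler_suml.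
  rewrite sumrN exchange_big /=; congr (- _); apply: eq_bigr => i _.
  by rewrite [X in _ *: X = _]wE scaler_sumr; apply: eq_bigr => j _; rewrite scalerA.
have wu' i : exists c' : 'I_k.+1 -> R[i], w i = \sum_j c' j *: u j.
  exists (fun j => oapp (c i) 0 (unlift ord0 j)).
  rewrite big_ord_recl unlift_none /= scale0r add0r wE.
  by apply: eq_bigr => j _; rewrite liftK.
(* If the new vector depends on the earlier ones, the system w is kept. *)
have [r0|r0] := eqVneq r 0.
  exists m, w; split=> // j; case: (unliftP ord0 j) => [j' ->|->]; first exact: uw.
  by apply/eqP; rewrite -subr_eq0 -/r r0.
exists m.+1, (fun i => oapp w (`|r|^-1 *: r) (unlift ord0 i)); split.
- move=> i j; case: (unliftP ord0 i) => [i' ->|->];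
  case: (unliftP ord0 j) => [j' ->|->]; rewrite ?liftK ?unlift_none /=.
  + by rewrite wO (inj_eq lift_inj).
  + by rewrite innerZr inner_conj rw rmorph0 mulr0.
  + by rewrite innerZl rw mulr0.
  + by rewrite unit_vector ?eqxx.
- move=> i; case: (unliftP ord0 i) => [i' _|_] /=; first exact: wu'.
  eexists (fun j => `|r|^-1 * _); rewrite {2}rE scaler_sumr.
  by apply: eq_bigr => j _; rewrite scalerA.
- have nr0 : `|r| != 0 by rewrite normr_eq0.
  move=> j; rewrite big_ord_recl unlift_none /=.
  under eq_bigr do rewrite liftK /=.
  case: (unliftP ord0 j) => [j' ->|->].
    rewrite -uw (_ : inner _ (_ *: r) = 0) ?scale0r ?add0r //.
    rewrite innerZr {1}uw inner_suml big1 ?mulr0 // => i _.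
    by rewrite innerZl [inner (w i) _]inner_conj rw rmorph0 mulr0.
  have uE : u ord0 = r + \sum_i inner (u ord0) (w i) *: w i by rewrite subrK.
  rewrite {1}uE; congr (_ + _).
  rewrite uE innerDl [X in _ + X]inner_suml [X in _ + X]big1; last first.
    by move=> i _; rewrite innerZl innerZr [inner (w i) _]inner_conj rw rmorph0 !mulr0.
  rewrite addr0 innerZr inner_norm conj_normV scalerA (_ : _ * _ = 1) ?scale1r //; by field.
Qed.

(** Tensoring a scalar matrix with the identity of H does not increase its norm:
    in an orthonormal system spanning the u_j the inequality splits into the
    scalar one, once for each coordinate. *)
Lemma scalar_amplification H k (phi : 'I_k -> 'I_k -> R[i]) B :
  (forall c : 'I_k -> R[i],
    \sum_i `|\sum_j phi i j * c j| ^+ 2 <= B * \sum_j `|c j| ^+ 2) ->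
  forall u : 'I_k -> H,
    \sum_i `|\sum_j phi i j *: u j| ^+ 2 <= B * \sum_j `|u j| ^+ 2.
Proof.
move=> phiB u; have [m [w [wO _ uw]]] := gram_schmidt u.
have normE (c : 'I_m -> R[i]) :
    `|\sum_l c l *: w l| ^+ 2 = \sum_l `|c l| ^+ 2.
  rewrite -inner_norm inner_orthonormal //.
  by apply: eq_bigr => l _; rewrite normCK.
have -> : \sum_j `|u j| ^+ 2 = \sum_l \sum_j `|inner (u j) (w l)| ^+ 2.
  by rewrite exchange_big /=; apply: eq_bigr => j _; rewrite {1}uw normE.
have -> : \sum_i `|\sum_j phi i j *: u j| ^+ 2 =
    \sum_l \sum_i `|\sum_j phi i j * inner (u j) (w l)| ^+ 2.
  rewrite exchange_big /=; apply: eq_bigr => i _; rewrite -normE.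
  congr (`|_| ^+ 2); under eq_bigr do rewrite uw scaler_sumr.
  rewrite exchange_big /=; apply: eq_bigr => l _; rewrite scaler_suml.
  by apply: eq_bigr => j _; rewrite scalerA.
by rewrite mulr_sumr; apply: ler_sum => l _; exact: phiB.
Qed.

(** Gram-Schmidt uses only inner products, so the combinations that make u
    orthonormal do the same for v.  Both systems are then the images of one
    system in a space of dimension m + 1; the first alternative covers the
    case in which that dimension would be 0, which is not a level. *)
Lemma gram_matching H1 H2 k (u : 'I_k -> H1) (v : 'I_k -> H2) :
  (forall i j, inner (u i) (u j) = inner (v i) (v j)) ->
  (forall j, u j = 0) /\ (forall j, v j = 0) \/
  exists m, forall G (b : 'I_m.+1 -> G), hilbert_basis b ->
    exists (a : bop G H1) (a' : bop G H2) (w : 'I_k -> G),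
    [/\ isometry a, isometry a', forall j, a (w j) = u j &
        forall j, a' (w j) = v j].
Proof.
move=> uv; have [m [w [wO wu uw]]] := gram_schmidt u.
have [c wE] := choice wu.
pose w' i := \sum_j c i j *: v j.
have uv_sum (d d' : 'I_k -> R[i]) :
    inner (\sum_j d j *: u j) (\sum_j d' j *: u j) =
    inner (\sum_j d j *: v j) (\sum_j d' j *: v j).
  rewrite !inner_suml; apply: eq_bigr => i _; rewrite !inner_sumr.
  by apply: eq_bigr => j _; rewrite !(innerZl, innerZr) uv.
have w'O : orthonormal_family w' by move=> i j; rewrite -wO !wE uv_sum.
have uE j : u j = \sum_l (l == j)%:R *: u l.
  rewrite (bigD1 j) //= eqxx scale1r big1 ?addr0 // => l lj.
  by rewrite (negbTE lj) scale0r.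
have vE j : v j = \sum_l (l == j)%:R *: v l.
  rewrite (bigD1 j) //= eqxx scale1r big1 ?addr0 // => l lj.
  by rewrite (negbTE lj) scale0r.
have uw_vw' j i : inner (u j) (w i) = inner (v j) (w' i).
  by rewrite uE wE uv_sum -vE.
have vw' j : v j = \sum_i inner (u j) (w i) *: w' i.
  apply/eqP; rewrite -subr_eq0; apply/eqP/inner_eq0.
  set s := \sum_i _.
  have sE : inner s s = \sum_i inner (u j) (w i) * (inner (u j) (w i))^*.
    exact: inner_orthonormal.
  have uu : inner (u j) (u j) = inner s s.
    by rewrite {1 2}uw inner_orthonormal // sE.
  have vs : inner (v j) s = inner s s.
    rewrite sE inner_sumr; apply: eq_bigr => i _.
    by rewrite innerZr uw_vw' mulrC.
  rewrite !(innerDl, innerDr, innerNl, innerNr) -uv uu vs.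
  have -> : inner s (v j) = inner s s.
    by rewrite [LHS]inner_conj vs -inner_conj.
  by ring.
case: m => [|m] in w wO wu uw c wE w' w'O uw_vw' vw' *.
  by left; split=> j; [rewrite uw|rewrite vw']; rewrite big_ord0.
right; exists m => G b bB.
have [a aI ab] := orthonormal_isometry bB wO.
have [a' a'I a'b] := orthonormal_isometry bB w'O.
exists a, a', (fun j => \sum_i inner (u j) (w i) *: b i); split=> // j.
  rewrite linear_sum [RHS]uw; apply: eq_bigr => i _; by rewrite linearZ /= ab.
rewrite linear_sum [RHS]vw'; apply: eq_bigr => i _; by rewrite linearZ /= a'b.
Qed.

End HilbertSpace.

(** * Levels of finite dimension *)

Section Levels.
Context {R : realType} {kappa : Type} {H : hilbert_levels R kappa}.

Lemma finite_level : infinite_set [set: kappa] ->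
  forall m, exists n (b : 'I_m.+1 -> H n), hilbert_basis b.
Proof.
move=> /infiniteP/card_leP[f] m.
pose iota (i : nat) : kappa := set_val (f (exist _ i (mem_set I))).
have iota_inj : injective iota.
  move=> i j /val_inj ij; have := @inj _ _ _ f _ _ _ _ ij.
  by move=> /(_ (mem_set I) (mem_set I)) [].
pose A0 := iota @` `I_m.+1.
have A0n : A0 !=set0 by exists (iota 0%N), 0%N.
pose n := @Cardinal kappa [set B | B #= A0] (ex_intro2 _ _ A0 A0n erefl).
have [A AA0 [e [eO eT]]] := hlevelP H n.
have /card_bijP[g [g' gK g'K]] : `I_m.+1 #= A.
  rewrite card_eq_sym; apply: card_eq_trans AA0 _.
  by apply: inj_card_eq => i j _ _; exact: iota_inj.
pose h (i : 'I_m.+1) : A := g (exist _ (i : nat) (mem_set (ltn_ord i))).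
exists n, (fun i => e (set_val (h i))); split=> [i j|v vb].
  rewrite eO ?set_valP //; try exact: set_mem (valP _).
  congr (_ %:R); congr nat_of_bool; apply/asboolP/eqP => [/val_inj|-> //].
  by move=> /(can_inj gK) [] /val_inj.
apply: eT => i Ai; pose x : A := exist _ i (mem_set Ai).
have := vb (Ordinal (set_mem (valP (g' x)))).
rewrite /h; set y := exist _ _ _.
have -> : y = g' x by apply: val_inj.
by rewrite g'K.
Qed.

Lemma level_unit_vector (n : cardinal kappa) : exists u : H n, inner u u = 1.
Proof.
have [A An [e [eO _]]] := hlevelP H n.
have [A0 [i Ai] nE] := card_classP n; rewrite nE in An.
have /card_bijP[g [g' _ _]] := An; pose j := g' (exist _ i (mem_set Ai)).
have Aj : A (set_val j) by exact: set_valP.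
exists (e (set_val j)); rewrite (eO _ _ Aj Aj).
by rewrite (_ : `[< _ >] = true) //; exact/asboolP.
Qed.

Lemma basis_unit (n : cardinal kappa) m (b : 'I_m.+1 -> H n) i :
  hilbert_basis b -> inner (b i) (b i) = 1.
Proof. by move=> [bO _]; rewrite bO eqxx. Qed.

Lemma unit_isometry (G F : hilbertType R) (b : 'I_1 -> G) (u : F) :
  hilbert_basis b -> inner u u = 1 ->
  exists2 a : bop G F, isometry a & a (b ord0) = u.
Proof.
move=> bB u1; have [|a aI ab] := @orthonormal_isometry _ _ _ _ _ (fun _ => u) bB.
  by move=> i j; rewrite u1 !ord1 eqxx.
by exists a.
Qed.

Lemma bop_line_ext (G : hilbertType R) (b : 'I_1 -> G) (S T : bop G G) : hilbert_basis b ->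
  inner (S (b ord0)) (b ord0) = inner (T (b ord0)) (b ord0) -> S = T.
Proof.
move=> bB ST; apply: bop_ext => v.
rewrite (basis_expansion v bB) big_ord1 !linearZ /=; congr (_ *: _).
by rewrite (basis_expansion (S _) bB) (basis_expansion (T _) bB) !big_ord1 ST.
Qed.

Lemma bop_scaleE (G F : hilbertType R) c (a : bop G F) u : (c *: a) u = c *: a u.
Proof. by []. Qed.

Lemma isometry_adjK (G F : hilbertType R) (a : bop G F) u : isometry a -> adj a (a u) = u.
Proof.
by move=> aI; apply: inner_ext => v; rewrite adjEl isometry_inner.
Qed.

End Levels.

(** * Completely bounded maps: scalar multiples of the identity, sums *)

Section CbMaps.
Context {R : realType} {V : operatorSpaceType R}.
Implicit Types G F : hilbertType R.

Lemma cbmap_ext G (x y : cbmap V G) : (forall e, x e = y e) -> x = y.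
Proof.
case: x y => [f fl fb] [g gl gb] /= fg.
have E : f = g by apply/funext.
by case: _ / E in gl gb *; congr CbMap; exact: Prop_irrelevance.
Qed.

Lemma inner_cb_linear G (x : cbmap V G) (u v : G) c e e' :
  inner (x (c *: e + e') u) v = c * inner (x e u) v + inner (x e' u) v.
Proof. by rewrite (cb_linear x) [LHS]innerDl innerZl. Qed.

Fact cb_scalar_linear G F (x : cbmap V G) (u : G) :
  linear (fun e => inner (x e u) u *: bid F).
Proof. by move=> c e e'; rewrite inner_cb_linear scalerDl scalerA. Qed.

Lemma cb_scalar_le G F (x : cbmap V G) (u : G) M : cbnorm_le x M ->
  cbnorm_le (fun e => inner (x e u) u *: bid F) (M * `|u| ^+ 2).
Proof.
move=> [M0 xM]; split=> [|k v]; first by rewrite mulr_ge0 ?exprn_ge0.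
apply: (@scalar_amplification _ F _ (fun i j => inner (x (v i j) u) u)) => c.
have -> : (M * `|u| ^+ 2 * mxnorm v) ^+ 2 * (\sum_j `|c j| ^+ 2) =
    ((M * mxnorm v) ^+ 2 * \sum_j `|c j *: u| ^+ 2) * `|u| ^+ 2.
  under [in RHS]eq_bigr do rewrite normrZ exprMn.
  by rewrite -mulr_suml; ring.
apply: le_trans (ler_wpM2r _ (xM k v (fun j => c j *: u))); last exact: exprn_ge0.
rewrite mulr_suml; apply: ler_sum => i _; rewrite -exprMn lerXn2r ?nnegrE ?mulr_ge0 //.
have -> : \sum_j inner (x (v i j) u) u * c j =
    inner (\sum_j x (v i j) (c j *: u)) u.
  by rewrite inner_suml; apply: eq_bigr => j _; rewrite linearZ innerZl mulrC.
exact: cauchy_schwarz.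
Qed.

Fact cb_scalar_bounded G F (x : cbmap V G) (u : G) :
  exists M, cbnorm_le (fun e => inner (x e u) u *: bid F) M.
Proof. by have [M xM] := cb_bounded x; eexists; exact: cb_scalar_le xM. Qed.

(** The functional e |-> <x(e) u, u> obtained by compressing x to the line of u,
    amplified to F. *)
Definition cb_scalar G F (x : cbmap V G) (u : G) : cbmap V F :=
  CbMap (@cb_scalar_linear G F x u) (@cb_scalar_bounded G F x u).

Fact cb_add_linear F (x y : cbmap V F) : linear (fun e => x e + y e).
Proof.
move=> c e f; rewrite (cb_linear x) (cb_linear y) scalerDr -!addrA.
by congr (_ + _); rewrite addrCA.
Qed.

Fact cb_add_bounded F (x y : cbmap V F) :
  exists M, cbnorm_le (fun e => x e + y e) M.
Proof.
have [[M [M0 xM]] [N [N0 yN]]] := (cb_bounded x, cb_bounded y).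
exists (2 * (M + N)); split=> [|k v u]; first by rewrite mulr_ge0 ?addr_ge0.
have par (z w : F) : `|z + w| ^+ 2 <= 2 * `|z| ^+ 2 + 2 * `|w| ^+ 2.
  (* parallelogram identity *)
  rewrite -subr_ge0 (_ : _ - _ = `|z - w| ^+ 2) ?exprn_ge0 //.
  by rewrite -!inner_norm !(innerDl, innerDr, innerNl, innerNr); ring.
apply: (@le_trans _ _ (2 * ((M * mxnorm v) ^+ 2 * \sum_j `|u j| ^+ 2) +
                       2 * ((N * mxnorm v) ^+ 2 * \sum_j `|u j| ^+ 2))).
  apply: (@le_trans _ _ (\sum_i (2 * `|\sum_j x (v i j) (u j)| ^+ 2 +
                                 2 * `|\sum_j y (v i j) (u j)| ^+ 2))).
    apply: ler_sum => i _; apply: le_trans (par _ _).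
    by rewrite -big_split.
  by rewrite big_split -!mulr_sumr lerD // ler_wpM2l.
set S := \sum_j _; have S0 : 0 <= S by apply: sumr_ge0 => j _; exact: exprn_ge0.
rewrite -subr_ge0 (_ : _ - _ = (2 * M ^+ 2 + 2 * N ^+ 2 + 8 * (M * N)) *
  mxnorm v ^+ 2 * S); last by ring.
by rewrite !mulr_ge0 ?addr_ge0 ?mulr_ge0 ?exprn_ge0 ?mxnorm_ge0.
Qed.

Definition cb_add F (x y : cbmap V F) : cbmap V F :=
  CbMap (@cb_add_linear F x y) (@cb_add_bounded F x y).

Lemma cbnorm_le_weak F (x : V -> bop F F) M N :
  M <= N -> cbnorm_le x M -> cbnorm_le x N.
Proof.
move=> MN [M0 xM]; have N0 := le_trans M0 MN; split=> // k v u.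
apply: le_trans (xM k v u) _; rewrite ler_wpM2r //.
  by apply: sumr_ge0 => j _; exact: exprn_ge0.
by rewrite lerXn2r ?nnegrE ?mulr_ge0 ?mxnorm_ge0 // ler_wpM2r ?mxnorm_ge0.
Qed.

End CbMaps.

Lemma cb_bounded2 (R : realType) (V W : operatorSpaceType R) (G F : hilbertType R)
    (x : cbmap V G) (y : cbmap W F) :
  exists M, cbnorm_le x M /\ cbnorm_le y M.
Proof.
have [[M xM] [N yN]] := (cb_bounded x, cb_bounded y); exists (M + N); split.
  by apply: cbnorm_le_weak xM; rewrite lerDl yN.1.
by apply: cbnorm_le_weak yN; rewrite lerDr xM.1.
Qed.

(** * Direct sums and scalar points in an nc convex set *)

Section DirectSums.
Context {R : realType} {kappa : Type} {H : hilbert_levels R kappa}.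
Implicit Types p q n : cardinal kappa.

Definition hilbert_sum2 p q n (a : bop (H p) (H n)) (a' : bop (H q) (H n)) :=
  [/\ isometry a, isometry a', forall u v, inner (a u) (a' v) = 0 &
      forall w, (forall u, inner (a u) w = 0) ->
                (forall v, inner (a' v) w = 0) -> w = 0].

(** Direct sums are indexed by arbitrary types with levels depending on the
    index; a pair of summands is a family over the booleans. *)
Definition bool_level p q (t : bool) := if t then p else q.

Definition bool_family (P : cardinal kappa -> Type) p q (x : P p) (y : P q)
    (t : bool) : P (bool_level p q t) :=
  match t return P (bool_level p q t) with true => x | false => y end.

Lemma hilbert_sum2_family p q n (a : bop (H p) (H n)) (a' : bop (H q) (H n)) :
  hilbert_sum2 a a' ->
  hilbert_sum (bool_family (P := fun m => bop (H m) (H n)) a a').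
Proof.
move=> [aI aI' aO aT]; split; first by case.
  case=> [] [] u v /= tt'; [by case: tt'|exact: aO| |by case: tt'].
  by rewrite inner_conj aO rmorph0.
by move=> w wa; apply: aT => u; [exact: (wa true)|exact: (wa false)].
Qed.

Lemma basis_sum2 p q n m m' (b : 'I_m.+1 -> H p) (b' : 'I_m'.+1 -> H q)
    (c : 'I_(m.+1 + m'.+1) -> H n) :
  hilbert_basis b -> hilbert_basis b' -> hilbert_basis c ->
  exists (a : bop (H p) (H n)) (a' : bop (H q) (H n)), hilbert_sum2 a a'.
Proof.
move=> bB bB' [cO cT].
have [|a aI ab] := @orthonormal_isometry _ _ _ _ _ (fun i => c (lshift _ i)) bB.
  by move=> i j; rewrite cO (inj_eq (@lshift_inj _ _)).
have [|a' aI' ab'] := @orthonormal_isometry _ _ _ _ _ (fun i => c (rshift _ i)) bB'.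
  by move=> i j; rewrite cO (inj_eq (@rshift_inj _ _)).
exists a, a'; split=> // [u v|w wa wa'].
  rewrite (basis_expansion u bB) (basis_expansion v bB') !linear_sum.
  rewrite inner_suml big1 // => i _; rewrite inner_sumr big1 // => j _.
  by rewrite !linearZ /= innerZl innerZr ab ab' cO eq_lrshift !mulr0.
apply: cT => i; case: (split_ordP i) => j ->.
  by rewrite -ab wa.
by rewrite -ab' wa'.
Qed.

(** Preservation of direct sums, for two summands.  It is phrased through
    intertwining rather than through a formula for the sum, so that it applies
    to a product of nc convex sets with points built in each factor separately. *)
Lemma nc_affine_sum2 (X : ncspace H) (K : ncset X) (f : graded_fun K) p q n
    (a : bop (H p) (H n)) (a' : bop (H q) (H n)) (x : K p) (x' : K q) (z : K n) :
  nc_affine f -> hilbert_sum2 a a' ->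
  (exists c, nball c (set_val x) /\ nball c (set_val x')) ->
  intertwines a (set_val x) (set_val z) ->
  intertwines a' (set_val x') (set_val z) ->
  bcomp (f n z) a = bcomp a (f p x) /\ bcomp (f n z) a' = bcomp a' (f q x').
Proof.
move=> [[fs _] _] /hilbert_sum2_family aa' [c [xc xc']] xz xz'.
have /(_ _ _ _) := fs bool _ n _ (bool_family (P := K) x x') z aa'.
have nb : norm_bounded (fun t => set_val (bool_family (P := K) x x' t)).
  by exists c; case.
have ds : is_dsum (bool_family (P := fun m => bop (H m) (H n)) a a')
    (fun t => set_val (bool_family (P := K) x x' t)) (set_val z) by case.
by move=> /(_ nb ds) D; split; [exact: (D true)|exact: (D false)].
Qed.

Lemma inner_sum2 p q n (a : bop (H p) (H n)) (a' : bop (H q) (H n))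
    (S : bop (H p) (H p)) (S' : bop (H q) (H q)) (T : bop (H n) (H n)) u v u' v' :
  hilbert_sum2 a a' -> bcomp T a = bcomp a S -> bcomp T a' = bcomp a' S' ->
  inner (T (a u + a' u')) (a v + a' v') = inner (S u) v + inner (S' u') v'.
Proof.
move=> [aI aI' aO _] Ta Ta'.
have -> : T (a u + a' u') = a (S u) + a' (S' u').
  rewrite linearD; congr (_ + _).
    exact: (congr1 (fun b => bop_fun b u) Ta).
  exact: (congr1 (fun b => bop_fun b u') Ta').
rewrite !(innerDl, innerDr) aO (inner_conj (a' _) (a _)) aO rmorph0.
by rewrite !isometry_inner // addr0 add0r.
Qed.

Context {V : operatorSpaceType R}.

(** The direct sum a x a^* + a' x' a'^* is again completely bounded, so it is a
    point of the ambient space and convexity puts it into K. *)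
Lemma cb_sum2_mem (K : ncset (ncME H V)) p q n (a : bop (H p) (H n)) (a' : bop (H q) (H n))
    (x : K p) (x' : K q) : nc_convex K -> hilbert_sum2 a a' ->
  exists z : K n, intertwines (n := n) a (set_val x) (set_val z) /\
                  intertwines (n := n) a' (set_val x') (set_val z).
Proof.
move=> Kc aa'; have [aI aI' aO _] := aa'.
pose z := cb_add (cb_compr (adj a) (set_val x)) (cb_compr (adj a') (set_val x')).
have a'0 u : adj a' (a u) = 0.
  by apply: inner_ext => v; rewrite adjEl aO inner0l.
have a0 u : adj a (a' u) = 0.
  by apply: inner_ext => v; rewrite adjEl inner_conj aO rmorph0 inner0l.
have xz e : bcomp (z e) a = bcomp a ((set_val x : cbmap V (H p)) e).
  apply: bop_ext => u.
  transitivity (adj (adj a) ((set_val x : cbmap V (H p)) e (adj a (a u))) +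
    adj (adj a') ((set_val x' : cbmap V (H q)) e (adj a' (a u)))); first by [].
  by rewrite !adjK a'0 !linear0 addr0 isometry_adjK.
have xz' e : bcomp (z e) a' = bcomp a' ((set_val x' : cbmap V (H q)) e).
  apply: bop_ext => u.
  transitivity (adj (adj a) ((set_val x : cbmap V (H p)) e (adj a (a' u))) +
    adj (adj a') ((set_val x' : cbmap V (H q)) e (adj a' (a' u)))); first by [].
  by rewrite !adjK a0 !linear0 add0r isometry_adjK.
have Kz : K n z.
  apply: (Kc.1 bool _ n _ (fun t => set_val (bool_family (P := K) x x' t)) z
           (hilbert_sum2_family aa')).
  - have [M [xM x'M]] := cb_bounded2 (set_val x : cbmap V (H p))
                                     (set_val x' : cbmap V (H q)).
    by exists M; case.
  - by case=> /=; exact: set_valP.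
  - by case.
by exists (exist _ z (mem_set Kz)).
Qed.

(** Compressed to the line of u0, the point x0 becomes a scalar multiple of the
    identity; the same multiple at level n is the direct sum of copies of it
    along an orthonormal basis of H n. *)
Lemma scalar_point_mem (K : ncset (ncME H V)) n1 (b : 'I_1 -> H n1) n0 (x0 : K n0)
    (u0 : H n0) n :
  nc_convex K -> hilbert_basis b -> inner u0 u0 = 1 ->
  K n (cb_scalar (H n) (set_val x0) u0).
Proof.
move=> Kc bB u01; have [a aI ab] := unit_isometry bB u01.
pose x1 : cbmap V (H n1) := cb_compr a (set_val x0).
have Kx1 : K n1 x1 by apply: Kc.2 aI _; exact: set_valP.
have x1E e : x1 e = inner ((set_val x0 : cbmap V (H n0)) e u0) u0 *: bid (H n1).
  apply: (bop_line_ext bB); rewrite /= adjEl ab.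
  by rewrite [RHS]innerZl (basis_unit _ bB) mulr1.
have [A _ [e [eO eT]]] := hlevelP H n.
have /choice[c cE] : forall i : A, exists c : bop (H n1) (H n),
    isometry c /\ c (b ord0) = e (set_val i).
  move=> i; have [|c cI cb] := @unit_isometry R _ (H n) b (e (set_val i)) bB.
    have Ai : A (set_val i) by exact: set_valP.
    by rewrite (eO _ _ Ai Ai) (_ : `[< _ >] = true) //; exact/asboolP.
  by exists c.
have cv i v : c i v = inner v (b ord0) *: e (set_val i).
  by rewrite {1}(basis_expansion v bB) big_ord1 linearZ /= (cE i).2.
apply: (Kc.1 A (fun=> n1) n c (fun=> x1)) => //; last first.
- move=> i f; apply: bop_ext => v.
  apply: etrans (esym (congr1 (fun T : bop _ _ => c i (T v)) (x1E f))).
  by rewrite bop_scaleE linearZ.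
- by have [M xM] := cb_bounded x1; exists M.
split=> [i|i j u v ij|w wc]; first exact: (cE i).1.
  have [Ai Aj] : A (set_val i) /\ A (set_val j) by split; exact: set_valP.
  rewrite !cv innerZl innerZr (eO _ _ Ai Aj).
  rewrite (_ : `[< _ >] = false) ?mulr0 //.
  by apply/asboolP => /val_inj.
apply: eT => i Ai; have := wc (exist _ i (mem_set Ai)) (b ord0).
by rewrite (cE _).2.
Qed.

End DirectSums.

(** * Nc affine functions are determined at level one *)

Section LevelOne.
Context {R : realType} {kappa : Type} {H : hilbert_levels R kappa}.
Context {X : ncspace H}.
Implicit Types K : ncset X.

Lemma ncA_compr K (f : ncA K) m n (a : bop (H m) (H n)) (x : K n) (y : K m) :
  isometry a -> set_val y = compr a (set_val x) ->
  f m y = bcomp (adj a) (bcomp (f n x) a).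
Proof. by have /asboolP[[_ fi] _] := ncAP f; exact: fi. Qed.

Lemma inner_ncA_compr K (f : ncA K) m n (a : bop (H m) (H n)) (x : K n) (y : K m) u v :
  isometry a -> set_val y = compr a (set_val x) ->
  inner (f m y u) v = inner (f n x (a u)) (a v).
Proof. by move=> aI yx; rewrite (ncA_compr _ aI yx) /= adjEl. Qed.

Definition compr_closed K := forall m n (a : bop (H m) (H n)) x,
  isometry a -> K n x -> K m (compr a x).

Lemma compr_point K m n (a : bop (H m) (H n)) (x : K n) :
  compr_closed K -> isometry a ->
  exists y : K m, set_val y = compr a (set_val x).
Proof.
move=> Kc aI; have Ky : K m (compr a (set_val x)) by apply: Kc aI _; exact: set_valP.
by exists (exist (fun z => z \in K m) _ (mem_set Ky)).
Qed.

(** By [bop_quad_unit_eq0] only the numbers <f(x) u, u> with u a unit vector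
    matter, and compressing x to the line of u computes them at level one. *)
Lemma ncA_ext_line K n1 (b : 'I_1 -> H n1) (f g : ncA K) :
  compr_closed K -> hilbert_basis b ->
  (forall x : K n1,
    inner (f n1 x (b ord0)) (b ord0) = inner (g n1 x (b ord0)) (b ord0)) ->
  f = g.
Proof.
move=> Kc bB fg; apply/val_inj/graded_fun_ext => n x.
apply/eqP; rewrite -subr_eq0; apply/eqP; apply: bop_quad_unit_eq0 => u u1.
have [a aI ab] := unit_isometry bB u1.
have [y yx] := compr_point x Kc aI.
rewrite -ab [LHS]innerDl [X in _ + X]innerNl.
rewrite -(inner_ncA_compr f _ _ aI yx) -(inner_ncA_compr g _ _ aI yx).
by rewrite fg subrr.
Qed.

End LevelOne.

(** * Functions of one variable on the product *)

Section Product.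
Context {R : realType} {kappa : Type} {H : hilbert_levels R kappa}.
Context {X1 X2 : ncspace H}.
Variables (K1 : ncset X1) (K2 : ncset X2).
Local Notation K12 := (prod_ncset K1 K2).
Local Notation point1 n := (set_type (@K1 n)).
Local Notation point2 n := (set_type (@K2 n)).
Local Notation point12 n := (set_type (@prod_ncset R kappa H X1 X2 K1 K2 n)).
Implicit Types n : cardinal kappa.

Definition prod_point n (x : point1 n) (y : point2 n) : point12 n :=
  sigT_of_setX (@K1 n) (@K2 n) (x, y).

Definition prod_fst n (z : point12 n) : point1 n :=
  (@setX_of_sigT _ _ (@K1 n) (@K2 n) z).1.

Definition prod_snd n (z : point12 n) : point2 n :=
  (@setX_of_sigT _ _ (@K1 n) (@K2 n) z).2.

Lemma prod_pointK n (z : point12 n) :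
  z = prod_point (prod_fst z) (prod_snd z).
Proof.
by rewrite /prod_point /prod_fst /prod_snd -surjective_pairing setX_of_sigTK.
Qed.

Lemma prod_fst_point n (x : point1 n) (y : point2 n) :
  prod_fst (prod_point x y) = x.
Proof. by rewrite /prod_fst /prod_point sigT_of_setXK. Qed.

Lemma prod_snd_point n (x : point1 n) (y : point2 n) :
  prod_snd (prod_point x y) = y.
Proof. by rewrite /prod_snd /prod_point sigT_of_setXK. Qed.

Lemma prod_fst_continuous n : continuous (@prod_fst n).
Proof.
move=> z; apply: (@continuous_comp _ _ _ (@setX_of_sigT _ _ (@K1 n) (@K2 n)) fst).
  exact: setX_of_sigT_continuous.
exact: cvg_fst.
Qed.

Lemma prod_snd_continuous n : continuous (@prod_snd n).
Proof.
move=> z; apply: (@continuous_comp _ _ _ (@setX_of_sigT _ _ (@K1 n) (@K2 n)) snd).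
  exact: setX_of_sigT_continuous.
exact: cvg_snd.
Qed.

Lemma prod_pointl_continuous n (y : point2 n) :
  continuous (fun x => prod_point x y).
Proof.
have pc (T U : topologicalType) (u : U) : continuous (fun x : T => (x, u)).
  by move=> x; apply: cvg_pair; [exact: cvg_id|exact: cvg_cst].
move=> x; apply: (@continuous_comp _ _ _ (fun x => (x, y))
  (@sigT_of_setX _ _ (@K1 n) (@K2 n))); first exact: pc.
exact: sigT_of_setX_continuous.
Qed.

Lemma prod_pointr_continuous n (x : point1 n) :
  continuous (fun y => prod_point x y).
Proof.
have pc (T U : topologicalType) (t : T) : continuous (fun y : U => (t, y)).
  by move=> y; apply: cvg_pair; [exact: cvg_cst|exact: cvg_id].
move=> y; apply: (@continuous_comp _ _ _ (fun y => (x, y))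
  (@sigT_of_setX _ _ (@K1 n) (@K2 n))); first exact: pc.
exact: sigT_of_setX_continuous.
Qed.

Fact ncA_fst_subproof (a : ncA K1) :
  ((fun n z => a n (prod_fst z)) : graded_fun K12) \in @nc_affine_continuous _ _ _ _ K12.
Proof.
have /asboolP[[[as_ au] ai] ac] := ncAP a; apply/asboolP; split; last first.
  move=> n z; apply: (continuous_comp (@prod_fst_continuous n z)).
  exact: ac.
split; first split.
- move=> I d n c x y cP [M xM] xy.
  apply: (as_ I d n c (fun i => prod_fst (x i)) (prod_fst y) cP).
    by exists M => i; exact: (xM i).1.
  by move=> i; exact: (xy i).1.
- by move=> m n c x y cU yx; apply: au cU _; exact: (congr1 fst yx).
- by move=> m n c x y cI yx; apply: ai cI _; exact: (congr1 fst yx).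
Qed.

Fact ncA_snd_subproof (a : ncA K2) :
  ((fun n z => a n (prod_snd z)) : graded_fun K12) \in @nc_affine_continuous _ _ _ _ K12.
Proof.
have /asboolP[[[as_ au] ai] ac] := ncAP a; apply/asboolP; split; last first.
  move=> n z; apply: (continuous_comp (@prod_snd_continuous n z)).
  exact: ac.
split; first split.
- move=> I d n c x y cP [M xM] xy.
  apply: (as_ I d n c (fun i => prod_snd (x i)) (prod_snd y) cP).
    by exists M => i; exact: (xM i).2.
  by move=> i; exact: (xy i).2.
- by move=> m n c x y cU yx; apply: au cU _; exact: (congr1 snd yx).
- by move=> m n c x y cI yx; apply: ai cI _; exact: (congr1 snd yx).
Qed.

Definition ncA_fst (a : ncA K1) : ncA K12 := NcA (ncA_fst_subproof a).
Definition ncA_snd (a : ncA K2) : ncA K12 := NcA (ncA_snd_subproof a).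

Lemma ncA_fst_linear : linear ncA_fst.
Proof. by move=> c a b; apply/val_inj/graded_fun_ext. Qed.

Lemma ncA_snd_linear : linear ncA_snd.
Proof. by move=> c a b; apply/val_inj/graded_fun_ext. Qed.

Lemma prod_compr_closed : compr_closed K1 -> compr_closed K2 -> compr_closed K12.
Proof.
by move=> c1 c2 m n a x aI [x1 x2]; split; [exact: c1|exact: c2].
Qed.

End Product.

(** * Splitting a function on the product *)

Section ScalarFamilies.
Context {R : realType} {kappa : Type} {H : hilbert_levels R kappa}.
Context {V : operatorSpaceType R}.
Hypothesis kappa_infinite : infinite_set [set: kappa].
Implicit Types m n : cardinal kappa.

Lemma cb_compr_scalar (F : hilbertType R) m n
    (a : bop (H m) (H n)) (x : cbmap V F) u : isometry a ->
  cb_scalar (H m) x u = cb_compr a (cb_scalar (H n) x u).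
Proof.
move=> aI; apply: cbmap_ext => e; apply: bop_ext => w.
by rewrite /= [RHS]linearZ /= isometry_adjK.
Qed.

Lemma intertwines_scalar (F : hilbertType R) m n
    (a : bop (H m) (H n)) (x : cbmap V F) u :
  @intertwines _ _ _ (ncME H V) m n a (cb_scalar (H m) x u) (cb_scalar (H n) x u).
Proof. by move=> e; apply: bop_ext => w; rewrite /= [RHS]linearZ. Qed.

(** One scalar point per level, all multiples of the identity by the same
    functional.  This makes the family uniformly bounded and stable under compressions and
    direct sums, which is what fixing one variable of an nc affine function
    requires. *)
Definition scalar_family (K : ncset (ncME H V)) (s : forall n, K n) :=
  exists (F : hilbertType R) (x : cbmap V F) u,
    forall n, set_val (s n) = cb_scalar (H n) x u.

Lemma scalar_family_exists (K : ncset (ncME H V)) :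
  nc_convex K -> (exists n, K n !=set0) -> exists s, scalar_family (K := K) s.
Proof.
move=> Kc [n [x Kx]]; have [n1 [b bB]] := @finite_level _ _ H kappa_infinite 0.
have [u u1] := @level_unit_vector _ _ H n.
pose x0 : K n := exist (fun z => z \in K n) x (mem_set Kx).
have sK m := @scalar_point_mem _ _ H V K n1 b n x0 u m Kc bB u1.
exists (fun m => exist (fun z => z \in K m) _ (mem_set (sK m))).
by exists (H n), x, u.
Qed.

Lemma scalar_family_bounded (K : ncset (ncME H V)) s :
  scalar_family (K := K) s ->
  exists2 M, 0 <= M & forall n, nball (n := n) M (set_val (s n)).
Proof.
move=> [F [x [u sE]]]; have [M xM] := cb_bounded x.
exists (M * `|u| ^+ 2) => [|n]; first by rewrite mulr_ge0 ?exprn_ge0 ?xM.1.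
by rewrite sE; exact: (@cb_scalar_le _ _ _ (H n) _ u _ xM).
Qed.

Lemma scalar_family_compr (K : ncset (ncME H V)) s m n (a : bop (H m) (H n)) :
  scalar_family (K := K) s -> isometry a ->
  set_val (s m) = compr a (set_val (s n)).
Proof. by move=> [F [x [u sE]]] aI; rewrite !sE; exact: cb_compr_scalar. Qed.

Lemma scalar_family_intertwines (K : ncset (ncME H V)) s m n
    (a : bop (H m) (H n)) :
  scalar_family (K := K) s -> intertwines a (set_val (s m)) (set_val (s n)).
Proof. by move=> [F [x [u sE]]]; rewrite !sE; exact: intertwines_scalar. Qed.

End ScalarFamilies.

Section Splitting.
Context {R : realType} {kappa : Type} {H : hilbert_levels R kappa}.
Context {V1 V2 : operatorSpaceType R}.
Variables (K1 : ncset (ncME H V1)) (K2 : ncset (ncME H V2)).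
Hypothesis kappa_infinite : infinite_set [set: kappa].
Hypotheses (K1c : nc_convex K1) (K2c : nc_convex K2).
Local Notation K12 := (prod_ncset K1 K2).
Local Notation point1 n := (set_type (@K1 n)).
Local Notation point2 n := (set_type (@K2 n)).
Implicit Types m n : cardinal kappa.

Fact ncA_slice1_subproof (f : ncA K12) (s : forall n, point2 n) :
  scalar_family s ->
  ((fun n x => f n (prod_point x (s n))) : graded_fun K1) \in
    @nc_affine_continuous _ _ _ _ K1.
Proof.
move=> sS; have [N N0 sN] := scalar_family_bounded sS.
have /asboolP[[[fs fu] fi] fc] := ncAP f; apply/asboolP; split; last first.
  move=> n x; apply: (@continuous_comp _ _ _ (fun x => prod_point x (s n))).
    exact: prod_pointl_continuous.
  exact: fc.
split; first split.
- move=> I d n c x y cP [M xM] xy.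
  apply: (fs I d n c (fun i => prod_point (x i) (s (d i))) (prod_point y (s n)) cP).
    exists (`|M| + N) => i; split.
      have M0 := (xM i).1; rewrite ger0_norm //.
      by apply: cbnorm_le_weak (xM i); rewrite lerDl.
    by apply: cbnorm_le_weak (sN _); rewrite lerDr.
  move=> i; split; first exact: xy.
  exact: scalar_family_intertwines.
- move=> m n c x y cU yx; apply: (fu _ _ _ _ _ cU); congr pair; first exact: yx.
  exact: scalar_family_compr sS cU.1.
- move=> m n c x y cI yx; apply: (fi _ _ _ _ _ cI); congr pair; first exact: yx.
  exact: scalar_family_compr sS cI.
Qed.

Fact ncA_slice2_subproof (f : ncA K12) (s : forall n, point1 n) :
  scalar_family s ->
  ((fun n y => f n (prod_point (s n) y)) : graded_fun K2) \in
    @nc_affine_continuous _ _ _ _ K2.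
Proof.
move=> sS; have [N N0 sN] := scalar_family_bounded sS.
have /asboolP[[[fs fu] fi] fc] := ncAP f; apply/asboolP; split; last first.
  move=> n y; apply: (@continuous_comp _ _ _ (fun y => prod_point (s n) y)).
    exact: prod_pointr_continuous.
  exact: fc.
split; first split.
- move=> I d n c x y cP [M xM] xy.
  apply: (fs I d n c (fun i => prod_point (s (d i)) (x i)) (prod_point (s n) y) cP).
    exists (`|M| + N) => i; split.
      by apply: cbnorm_le_weak (sN _); rewrite lerDr.
    have M0 := (xM i).1; rewrite ger0_norm //.
    by apply: cbnorm_le_weak (xM i); rewrite lerDl.
  move=> i; split; last exact: xy.
  exact: scalar_family_intertwines.
- move=> m n c x y cU yx; apply: (fu _ _ _ _ _ cU); congr pair; last exact: yx.
  exact: scalar_family_compr sS cU.1.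
- move=> m n c x y cI yx; apply: (fi _ _ _ _ _ cI); congr pair; last exact: yx.
  exact: scalar_family_compr sS cI.
Qed.

(** In level two, x (+) x0 paired with y (+) y0 and with y0 (+) y gives two points
    with the same compression to the line of w = (1, 1), because exchanging
    the summands y and y0 does not change their average.  Each side is twice
    the value of f at this common compression. *)
Lemma ncA_exchange (f : ncA K12) n1 (b : 'I_1 -> H n1)
    (x x0 : point1 n1) (y y0 : point2 n1) :
  hilbert_basis b ->
  let st (z : bop (H n1) (H n1)) := inner (z (b ord0)) (b ord0) in
  st (f n1 (prod_point x y)) + st (f n1 (prod_point x0 y0)) =
  st (f n1 (prod_point x y0)) + st (f n1 (prod_point x0 y)).
Proof.
move=> bB st.
have [n [c cB]] := @finite_level _ _ H kappa_infinite 1.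
have [a [a' aa']] := @basis_sum2 _ _ _ _ _ _ 0 0 b b c bB bB cB.
have [z1 [z1x z1x0]] := cb_sum2_mem x x0 K1c aa'.
have [z2 [z2y z2y0]] := cb_sum2_mem y y0 K2c aa'.
have [z3 [z3y0 z3y]] := cb_sum2_mem y0 y K2c aa'.
pose w := a (b ord0) + a' (b ord0).
have w0 : w != 0.
  apply/eqP => w0; have := inner0l (a (b ord0)); rewrite -{1}w0 innerDl.
  have [aI _ aO _] := aa'.
  rewrite isometry_inner // (basis_unit _ bB) inner_conj aO rmorph0 addr0.
  by move/eqP; rewrite oner_eq0.
have [al alI alb] := unit_isometry bB (unit_vector w0).
have c0 : `|w|^-1 != 0 by rewrite invr_eq0 normr_eq0.
have c0' : (`|w|^-1)^* != 0 by rewrite conjC_eq0.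
have wE (T : bop (H n) (H n)) : inner (T (al (b ord0))) (al (b ord0)) =
    `|w|^-1 * ((`|w|^-1)^* * inner (T w) w).
  by rewrite alb linearZ /= innerZl innerZr.
have nballs (v : point1 n1) (v' : point2 n1) (t : point1 n1)
    (t' : point2 n1) :
    exists d, @nball _ _ _ (ncprod (ncME H V1) (ncME H V2)) n1 d
                (set_val (prod_point v v')) /\
              @nball _ _ _ (ncprod (ncME H V1) (ncME H V2)) n1 d
                (set_val (prod_point t t')).
  have [M [vM v'M]] := cb_bounded2 (set_val v : cbmap V1 (H n1))
                                   (set_val v' : cbmap V2 (H n1)).
  have [N [tN t'N]] := cb_bounded2 (set_val t : cbmap V1 (H n1))
                                   (set_val t' : cbmap V2 (H n1)).
  have [MD ND] : M <= M + N /\ N <= M + N by rewrite lerDl lerDr vM.1 tN.1.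
  by exists (M + N); split; split; [apply: cbnorm_le_weak vM|
    apply: cbnorm_le_weak v'M|apply: cbnorm_le_weak tN|apply: cbnorm_le_weak t'N].
have compr_eq : cb_compr al (set_val z2 : cbmap V2 (H n)) =
    cb_compr al (set_val z3 : cbmap V2 (H n)).
  apply: cbmap_ext => e; apply: (bop_line_ext bB); rewrite /= !adjEl !wE.
  rewrite (inner_sum2 _ _ _ _ aa' (z2y e) (z2y0 e)).
  by rewrite (inner_sum2 _ _ _ _ aa' (z3y0 e) (z3y e)) addrC.
have K12c := prod_compr_closed K1c.2 K2c.2.
have [q qE] := compr_point (prod_point z1 z2) K12c alI.
have qE' : set_val q = compr al (set_val (prod_point z1 z3)).
  by rewrite qE; congr pair; exact: compr_eq.
have := inner_ncA_compr f (b ord0) (b ord0) alI qE'.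
rewrite (inner_ncA_compr f (b ord0) (b ord0) alI qE) !wE.
move=> /(mulfI c0)/(mulfI c0').
have /asboolP[fA _] := ncAP f.
have [E1 E2] := nc_affine_sum2 fA aa' (nballs x y x0 y0)
  (conj z1x z2y : intertwines a (set_val (prod_point x y)) (set_val (prod_point z1 z2)))
  (conj z1x0 z2y0 : intertwines a' (set_val (prod_point x0 y0)) (set_val (prod_point z1 z2))).
have [E3 E4] := nc_affine_sum2 fA aa' (nballs x y0 x0 y)
  (conj z1x z3y0 : intertwines a (set_val (prod_point x y0)) (set_val (prod_point z1 z3)))
  (conj z1x0 z3y : intertwines a' (set_val (prod_point x0 y)) (set_val (prod_point z1 z3))).
by rewrite (inner_sum2 _ _ _ _ aa' E1 E2) (inner_sum2 _ _ _ _ aa' E3 E4).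
Qed.

End Splitting.

(** * A Hahn-Banach sandwich theorem in finite dimension *)

Section Sandwich.
Context {R : realType} {E : lmodType R[i]}.
Local Notation rc := (real_complex R).
Implicit Types (P : E -> R -> Prop) (g : E) (r t : R).

(** [P g r] reads: r is an admissible upper bound for the value at g of the
    functional sought.  The last condition says that the zero functional on
    the zero space meets these bounds. *)
Definition nonneg_cone P :=
  [/\ forall g r g' r', P g r -> P g' r' -> P (g + g') (r + r'),
      forall t g r, 0 < t -> P g r -> P (rc t *: g) (t * r) &
      forall r, P 0 r -> 0 <= r].

(** The largest value at e that the bounds P e r allow also meets the bounds at
    - e: a bound r at e and a bound s at - e add up to a bound at 0, so
    - s <= r. *)
Lemma cone_slope P e : nonneg_cone P ->
  (exists r, P e r) -> (exists r, P (- e) r) ->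
  exists l, forall t r, P (rc t *: e) r -> t * l <= r.
Proof.
move=> [PD PZ P0] [r0 Pr0] [s0 Ps0]; pose A := [set r | P e r].
have lbA r s : P e r -> P (- e) s -> - s <= r.
  move=> Pr Ps; have := PD _ _ _ _ Pr Ps; rewrite subrr => /P0; lra.
have A_inf : has_inf A by split; [exists r0|exists (- s0) => r Ar; exact: lbA].
exists (inf A) => t r Pr; have [t0|t0|t0] := ltgtP t 0.
- have t'0 : 0 < - t by rewrite oppr_gt0.
  have Pr' : P (- e) (r / - t).
    rewrite mulrC; have -> : - e = rc (- t)^-1 *: (rc t *: e).
      rewrite scalerA -rmorphM /= invrN mulNr mulVf ?lt_eqF //.
      by rewrite rmorphN1 scaleN1r.
    by apply: PZ; rewrite // invr_gt0.
  have : - (r / - t) <= inf A.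
    by apply: lb_le_inf => [|s As]; [exists r0|exact: lbA].
  rewrite lerNl ler_pdivlMr // mulrN mulNr opprK mulrC; exact.
- have Pr' : P e (r / t).
    rewrite mulrC; have -> : e = rc t^-1 *: (rc t *: e).
      by rewrite scalerA -rmorphM /= mulVf ?gt_eqF // rmorph1 scale1r.
    by apply: PZ; rewrite // invr_gt0.
  rewrite mulrC -ler_pdivlMr //; apply: ge_inf Pr'; exact: A_inf.2.
- by rewrite t0 mul0r; apply: P0; rewrite -(scale0r e) -(rmorph0 rc) -t0.
Qed.

(** Once the value l0 at the first direction is fixed, shifting each bound by the
    contribution of that direction leaves a cone of the same kind for the
    remaining directions.  The hypotheses on e i and - e i keep the interval of
    admissible values bounded at every stage. *)
Lemma cone_functional d (e : 'I_d -> E) P : nonneg_cone P ->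
  (forall i, exists r, P (e i) r) -> (forall i, exists r, P (- e i) r) ->
  exists l : 'I_d -> R, forall (t : 'I_d -> R) r,
    P (\sum_i rc (t i) *: e i) r -> \sum_i t i * l i <= r.
Proof.
elim: d e P => [|d IH] e P Pc Pe PNe.
  exists (fun=> 0) => t r; rewrite !big_ord0; by case: Pc => _ _; exact.
have [l0 l0P] := cone_slope Pc (Pe ord0) (PNe ord0).
pose P' g r := exists t, P (g + rc t *: e ord0) (r + t * l0).
have PP' g r : P g r -> P' g r.
  by exists 0; rewrite mul0r addr0 rmorph0 scale0r addr0.
have [PD PZ P0] := Pc.
have [|||l lP] := IH (fun i => e (lift ord0 i)) P'.
- split=> [g r g' r' [t Pg] [t' Pg']|t g r t0 [t' Pg]|r [t Pr]].
  + exists (t + t'); have := PD _ _ _ _ Pg Pg'; congr (P _ _).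
      by rewrite rmorphD scalerDl addrACA.
    by ring.
  + exists (t * t'); have := PZ _ _ _ t0 Pg; congr (P _ _).
      by rewrite scalerDr scalerA rmorphM.
    by ring.
  + by move: Pr; rewrite add0r => /l0P; rewrite lerDr.
- by move=> i; have [r Pr] := Pe (lift ord0 i); exists r; exact: PP'.
- by move=> i; have [r Pr] := PNe (lift ord0 i); exists r; exact: PP'.
exists (fun i => oapp l l0 (unlift ord0 i)) => t r.
rewrite !big_ord_recl unlift_none /= addrC => Pr.
under eq_bigr do rewrite liftK /=.
rewrite -lerBrDl; apply: lP; exists (t ord0).
by rewrite subrK.
Qed.

Lemma cone_functional_fin (I : finType) (e : I -> E) P : nonneg_cone P ->
  (forall i, exists r, P (e i) r) -> (forall i, exists r, P (- e i) r) ->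
  exists l : I -> R, forall (t : I -> R) r,
    P (\sum_i rc (t i) *: e i) r -> \sum_i t i * l i <= r.
Proof.
move=> Pc Pe PNe.
have [l lP] := cone_functional (e := fun j : 'I_#|I| => e (enum_val j)) Pc
  (fun j => Pe _) (fun j => PNe _).
exists (fun i => l (enum_rank i)) => t r.
rewrite (reindex _ (onW_bij _ (@enum_val_bij I))) /=.
rewrite [X in _ -> X <= _](reindex _ (onW_bij _ (@enum_val_bij I))) /=.
by under [X in _ -> X <= _]eq_bigr do rewrite enum_valK; exact: lP.
Qed.

End Sandwich.

(** * Gram matrices *)

Section QuadraticForm.
Context {R : realType}.
Implicit Types G : hilbertType R.

Lemma complex_rect (z : R[i]) :
  z = real_complex R (complex.Re z) + 'i * real_complex R (complex.Im z).
Proof.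
case: z => x y; apply/eqP; rewrite eq_complex /=.
by rewrite !(mul0r, mul1r, mulr0, addr0, add0r, subr0) !eqxx.
Qed.

Lemma conj_rc (x : R) : (real_complex R x)^* = real_complex R x.
Proof. by apply/eqP; rewrite eq_complex /= oppr0 !eqxx. Qed.

Lemma conj_rect (z : R[i]) :
  z^* = real_complex R (complex.Re z) - 'i * real_complex R (complex.Im z).
Proof. by rewrite {1}(complex_rect z) rmorphD rmorphM /= conjCi !conj_rc mulNr. Qed.

(** The indices are exchanged with respect to inner (u i) (u j), so that
    [trace_pairing l (gram u)] is the value at u of the quadratic form of the
    scalar matrix l. *)
Definition gram G k (u : 'I_k -> G) : 'M[R[i]]_k :=
  \matrix_(i, j) inner (u j) (u i).

Definition trace_pairing k (l g : 'M[R[i]]_k) : R[i] :=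
  \sum_i \sum_j l i j * g i j.

(** A spanning family over the reals of the Hermitian matrices; the third index
    selects the real or the imaginary part of an entry. *)
Definition polar_direction k (d : 'I_k * 'I_k * bool) : 'M[R[i]]_k :=
  let s : R[i] := if d.2 then 'i else 1 in
  2^-1 *: (s *: delta_mx d.1.1 d.1.2 + s^* *: delta_mx d.1.2 d.1.1).

Definition polar_coord k (g : 'M[R[i]]_k) (d : 'I_k * 'I_k * bool) : R :=
  if d.2 then complex.Im (g d.1.1 d.1.2) else complex.Re (g d.1.1 d.1.2).

Lemma gram_hermitian G k (u : 'I_k -> G) i j : gram u j i = (gram u i j)^*.
Proof. by rewrite !mxE inner_conj. Qed.

Lemma sum_polar k (W : zmodType) (F : 'I_k * 'I_k * bool -> W) :
  \sum_d F d = \sum_i \sum_j (F (i, j, false) + F (i, j, true)).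
Proof.
transitivity (\sum_p \sum_t F (p, t)).
  by rewrite pair_bigA; apply: eq_bigr => -[].
rewrite [RHS]pair_bigA; apply: eq_bigr => -[i j] _.
by rewrite big_bool addrC.
Qed.

Lemma polar_expansion k (g : 'M[R[i]]_k) : (forall i j, g j i = (g i j)^*) ->
  g = \sum_d real_complex R (polar_coord g d) *: polar_direction d.
Proof.
move=> gH; rewrite sum_polar.
have E i j : real_complex R (polar_coord g (i, j, false)) *:
      polar_direction (i, j, false) +
    real_complex R (polar_coord g (i, j, true)) *: polar_direction (i, j, true) =
    2^-1 *: (g i j *: delta_mx i j) + 2^-1 *: (g j i *: delta_mx j i).
  have := conj_rect (g i j); have := complex_rect (g i j).
  rewrite (gH i j) /polar_coord /polar_direction /=.
  move: (real_complex R _) (real_complex R _) => x y zE zcE.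
  have comb (C : comNzRingType) (W : lmodType C) (c p q s t : C) (A B : W) :
      p *: (c *: (1 *: A + 1 *: B)) + q *: (c *: (s *: A + t *: B)) =
      c *: ((p + s * q) *: A) + c *: ((p + t * q) *: B).
    rewrite !scalerDr !scalerA addrACA -!scalerDl.
    by congr (_ *: _ + _ *: _); ring.
  by rewrite rmorph1 comb zcE zE conjCi mulNr.
under eq_bigr do (under eq_bigr do rewrite E; rewrite big_split).
rewrite big_split /= [X in _ + X]exchange_big /=.
have S : \sum_i \sum_j 2^-1 *: (g i j *: delta_mx i j) = 2^-1 *: g.
  rewrite [in RHS](matrix_sum_delta g) scaler_sumr.
  by apply: eq_bigr => i _; rewrite scaler_sumr.
rewrite S -scalerDl (_ : 2^-1 + 2^-1 = 1) ?scale1r //; by field.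
Qed.

(** Polarization: the rank one Gram matrices of e_i + s e_j and of e_i - s e_j
    differ by the mixed terms. *)
Lemma polar_direction_gram G (b : G) k (d : 'I_k * 'I_k * bool) :
  inner b b = 1 ->
  exists u v : 'I_k -> G, polar_direction d = gram u - gram v.
Proof.
case: d => [[i j] t] b1; pose s : R[i] := if t then 'i else 1.
pose c (e : R[i]) p := 2^-1 * ((p == i)%:R + e * s * (p == j)%:R).
exists (fun p => c 1 p *: b), (fun p => c (-1) p *: b).
apply/matrixP => p q; rewrite !mxE !innerZl !innerZr b1 /=.
have cC e r : (c e r)^* = 2^-1 * ((r == i)%:R + e^* * s^* * (r == j)%:R).
  by rewrite /c rmorphM /= fmorphV /= rmorph_nat rmorphD /= !rmorphM /= !rmorph_nat.
rewrite -/(c _ _) -!/(c _ _) !mulr1 !cC /c rmorphN rmorph1 -/s -!mulnb !natrM.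
clear cC c.
move: (p == i)%:R (p == j)%:R (q == i)%:R (q == j)%:R (s^*) (s) => A B C D t' u.
by field.
Qed.

(** The minus sign turns the real part of a product of entries into the sum of
    the products of real and of imaginary parts, see [Re_trace_pairing]. *)
Definition coord_matrix k (l : 'I_k * 'I_k * bool -> R) : 'M[R[i]]_k :=
  \matrix_(i, j) (real_complex R (l (i, j, false)) -
                  'i * real_complex R (l (i, j, true))).

Lemma Re_sum (I : finType) (F : I -> R[i]) :
  complex.Re (\sum_i F i) = \sum_i complex.Re (F i).
Proof. exact: (big_morph _ ReD erefl). Qed.

Lemma Re_trace_pairing k (l : 'I_k * 'I_k * bool -> R) (g : 'M[R[i]]_k) :
  complex.Re (trace_pairing (coord_matrix l) g) = \sum_d polar_coord g d * l d.
Proof.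
rewrite sum_polar Re_sum; apply: eq_bigr => i _.
rewrite Re_sum; apply: eq_bigr => j _; rewrite mxE /polar_coord /=.
by case: (g i j) => x y /=; ring.
Qed.

Lemma trace_pairingN k (l g : 'M[R[i]]_k) :
  trace_pairing l (- g) = - trace_pairing l g.
Proof.
rewrite /trace_pairing -sumrN; apply: eq_bigr => i _.
by rewrite -sumrN; apply: eq_bigr => j _; rewrite [(- g) i j]mxE mulrN.
Qed.

(** Its pairing with a Hermitian matrix is the real part of the pairing with
    l, see [trace_pairing_herm]. *)
Definition herm_part k (l : 'M[R[i]]_k) : 'M[R[i]]_k :=
  \matrix_(i, j) (2^-1 * (l i j + (l j i)^*)).

Lemma trace_pairing_herm k (l g : 'M[R[i]]_k) : (forall i j, g j i = (g i j)^*) ->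
  trace_pairing (herm_part l) g =
  real_complex R (complex.Re (trace_pairing l g)).
Proof.
move=> gH; have -> (z : R[i]) : real_complex R (complex.Re z) = 2^-1 * (z + z^*).
  rewrite {2}(complex_rect z) conj_rect; by field.
have E : (trace_pairing l g)^* = \sum_i \sum_j (l j i)^* * g i j.
  rewrite /trace_pairing rmorph_sum [RHS]exchange_big /=.
  apply: eq_bigr => i _; rewrite rmorph_sum /=.
  by apply: eq_bigr => j _; rewrite rmorphM /= -(gH i j).
rewrite E /trace_pairing -big_split mulr_sumr; apply: eq_bigr => i _ /=.
rewrite -big_split mulr_sumr; apply: eq_bigr => j _ /=.
by rewrite mxE -mulrA mulrDl.
Qed.

End QuadraticForm.

(** * Separation of matrices of nc affine functions *)

Section MatrixOrder.
Context {R : realType} {kappa : Type} {H : hilbert_levels R kappa}.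
Implicit Types n : cardinal kappa.

Definition mx_form (X : ncspace H) (K : ncset X) k (a : 'M[ncA K]_k) n (x : K n)
    (u : 'I_k -> H n) : R[i] :=
  \sum_i \sum_j inner (a i j n x (u j)) (u i).

Lemma mx_form0 (X : ncspace H) (K : ncset X) k (a : 'M[ncA K]_k) n (x : K n) :
  mx_form a x (fun=> 0) = 0.
Proof. by rewrite /mx_form big1 // => i _; rewrite big1 // => j _; rewrite inner0r. Qed.

Lemma gram0 n k : gram (fun _ : 'I_k => 0 : H n) = 0.
Proof. by apply/matrixP => i j; rewrite !mxE inner0r. Qed.

Lemma mx_formZ (X : ncspace H) (K : ncset X) k (a : 'M[ncA K]_k) n (x : K n) c u :
  mx_form a x (fun j => c *: u j) = c * c^* * mx_form a x u.
Proof.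
rewrite /mx_form mulr_sumr; apply: eq_bigr => i _; rewrite mulr_sumr.
by apply: eq_bigr => j _; rewrite linearZ /= innerZl innerZr mulrA.
Qed.

Lemma gramZ n k c (u : 'I_k -> H n) :
  gram (fun j => c *: u j) = (c * c^*) *: gram u.
Proof. by apply/matrixP => i j; rewrite !mxE innerZl innerZr mulrA. Qed.

Lemma mx_form_compr (X : ncspace H) (K : ncset X) k (a : 'M[ncA K]_k) m n
    (c : bop (H m) (H n)) (x : K n) (y : K m) u :
  isometry c -> set_val y = compr c (set_val x) ->
  mx_form a y u = mx_form a x (fun j => c (u j)).
Proof.
move=> cI yx; apply: eq_bigr => i _; apply: eq_bigr => j _.
exact: inner_ncA_compr.
Qed.

Lemma gram_sum2 p q n k (c : bop (H p) (H n)) (c' : bop (H q) (H n))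
    (u : 'I_k -> H p) (u' : 'I_k -> H q) : hilbert_sum2 c c' ->
  gram (fun j => c (u j) + c' (u' j)) = gram u + gram u'.
Proof.
move=> cc'; apply/matrixP => i j; rewrite !mxE.
by apply: (@inner_sum2 _ _ _ _ _ _ _ _ (bid (H p)) (bid (H q)) (bid (H n)) _ _ _ _ cc');
  exact: bop_ext.
Qed.

Lemma mx_form_sum2 (V : operatorSpaceType R) (K : ncset (ncME H V)) k
    (a : 'M[ncA K]_k) p q n (c : bop (H p) (H n)) (c' : bop (H q) (H n))
    (x : K p) (x' : K q) : nc_convex K -> hilbert_sum2 c c' ->
  exists z : K n, forall u u',
    mx_form a z (fun j => c (u j) + c' (u' j)) = mx_form a x u + mx_form a x' u'.
Proof.
move=> Kc cc'; have [z [zx zx']] := cb_sum2_mem x x' Kc cc'; exists z => u u'.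
rewrite /mx_form -big_split; apply: eq_bigr => i _ /=.
rewrite -big_split; apply: eq_bigr => j _ /=.
have nb := cb_bounded2 (set_val x : cbmap V (H p)) (set_val x' : cbmap V (H q)).
have /asboolP[fA _] := ncAP (a i j).
have [E E'] := nc_affine_sum2 fA cc' nb zx zx'.
exact: inner_sum2 cc' E E'.
Qed.

Definition finite_dim n := exists m (b : 'I_m.+1 -> H n), hilbert_basis b.

Lemma finite_dim_sum2 p q : infinite_set [set: kappa] ->
  finite_dim p -> finite_dim q ->
  exists n (c : bop (H p) (H n)) (c' : bop (H q) (H n)),
    finite_dim n /\ hilbert_sum2 c c'.
Proof.
move=> kinf [m [b bB]] [m' [b' bB']].
have [n [d dB]] := @finite_level _ _ H kinf (m + m'.+1).
have [c [c' cc']] := @basis_sum2 _ _ _ _ _ _ m m' b b' d bB bB' dB.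
by exists n, c, c'; split=> //; exists (m + m'.+1)%N, d.
Qed.

Context {V1 V2 : operatorSpaceType R}.
Variables (K1 : ncset (ncME H V1)) (K2 : ncset (ncME H V2)).
Hypothesis kappa_infinite : infinite_set [set: kappa].
Hypotheses (K1c : nc_convex K1) (K2c : nc_convex K2).
Hypotheses (K1n : exists n, @K1 n !=set0) (K2n : exists n, @K2 n !=set0).
Local Notation point1 n := (set_type (@K1 n)).
Local Notation point2 n := (set_type (@K2 n)).

(** Compressing to the span of the u_j reduces any level to one of finite
    dimension, where direct sums of two levels are again levels. *)
Lemma finite_dim_reduction (V : operatorSpaceType R) (K : ncset (ncME H V)) k n
    (x : K n) (u : 'I_k -> H n) : nc_convex K ->
  exists p (y : K p) (v : 'I_k -> H p),
  [/\ finite_dim p, gram v = gram u &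
      forall a : 'M[ncA K]_k, mx_form a y v = mx_form a x u].
Proof.
move=> Kc; have uu i j : inner (u i) (u j) = inner (u i) (u j) by [].
have [[u0 _]|[m mP]] := gram_matching uu.
  have -> : u = fun=> 0 by apply/funext.
  have [s _] := scalar_family_exists kappa_infinite Kc
    (ex_intro _ n (ex_intro _ _ (set_valP x))).
  have [p [b bB]] := @finite_level _ _ H kappa_infinite 0.
  exists p, (s p), (fun=> 0); split; first by exists 0%N, b.
    by rewrite !gram0.
  by move=> a; rewrite !mx_form0.
have [p [b bB]] := @finite_level _ _ H kappa_infinite m.
have [d [_ [t [dI _ dt _]]]] := mP _ b bB.
have [y yx] := compr_point x Kc.2 dI.
have uE : u = fun j => d (t j) by apply/funext.
exists p, y, t; split=> [||a]; first by exists m, b.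
  by rewrite uE; apply/matrixP => i j; rewrite !mxE isometry_inner.
by rewrite (mx_form_compr a _ dI yx) uE.
Qed.

(** The bounds imposed on the functional l: a pair (x, u) bounds its value at
    gram u, a pair (y, v) bounds its value at - gram v.  The factor w, equal to
    1 or to - i below, selects the real or the imaginary part. *)
Definition form_cone k (w : R[i]) (a : 'M[ncA K1]_k) (b : 'M[ncA K2]_k)
    (g : 'M[R[i]]_k) (r : R) :=
  exists p q (x : point1 p) (y : point2 q) u v,
  [/\ finite_dim p, finite_dim q, g = gram u - gram v &
      r = complex.Re (w * (mx_form a x u + mx_form b y v))].

(** Equal Gram matrices allow the two systems to be moved to a common level,
    where x and y form a point of the product. *)
Lemma mx_form_matched k (a : 'M[ncA K1]_k) (b : 'M[ncA K2]_k) (w : R[i]) :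
  (forall n (x : point1 n) (y : point2 n) u,
    0 <= complex.Re (w * (mx_form a x u + mx_form b y u))) ->
  forall p q (x : point1 p) (y : point2 q) u v,
    gram u = gram v -> 0 <= complex.Re (w * (mx_form a x u + mx_form b y v)).
Proof.
move=> ab0 p q x y u v uv.
have uvE i j : inner (u i) (u j) = inner (v i) (v j).
  by have /matrixP/(_ j i) := uv; rewrite !mxE.
have [[u0 v0]|[m mP]] := gram_matching uvE.
  have -> : u = fun=> 0 by apply/funext.
  have -> : v = fun=> 0 by apply/funext.
  by rewrite !mx_form0 addr0 mulr0.
have [n [c cB]] := @finite_level _ _ H kappa_infinite m.
have [d [d' [t [dI d'I dt d't]]]] := mP _ c cB.
have [x' x'x] := compr_point x K1c.2 dI.
have [y' y'y] := compr_point y K2c.2 d'I.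
have := ab0 n x' y' t.
rewrite (mx_form_compr a _ dI x'x) (mx_form_compr b _ d'I y'y).
have -> : (fun j => d (t j)) = u by apply/funext.
by have -> : (fun j => d' (t j)) = v by apply/funext.
Qed.

Lemma form_coneP k (w : R[i]) (a : 'M[ncA K1]_k) (b : 'M[ncA K2]_k) :
  (forall n (x : point1 n) (y : point2 n) u,
    0 <= complex.Re (w * (mx_form a x u + mx_form b y u))) ->
  nonneg_cone (form_cone w a b).
Proof.
move=> ab0; split.
- move=> g r g' r' [p [q [x [y [u [v [pF qF -> ->]]]]]]].
  move=> [p' [q' [x' [y' [u' [v' [pF' qF' -> ->]]]]]]].
  have [n [c [c' [nF cc']]]] := finite_dim_sum2 kappa_infinite pF pF'.
  have [m [d [d' [mF dd']]]] := finite_dim_sum2 kappa_infinite qF qF'.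
  have [z zE] := mx_form_sum2 a x x' K1c cc'.
  have [t tE] := mx_form_sum2 b y y' K2c dd'.
  exists n, m, z, t, (fun j => c (u j) + c' (u' j)), (fun j => d (v j) + d' (v' j)).
  split=> //; first by rewrite !gram_sum2 // opprD addrACA.
  by rewrite zE tE -ReD -mulrDr addrACA.
- move=> t g r t0 [p [q [x [y [u [v [pF qF -> ->]]]]]]].
  pose s := real_complex R (Num.sqrt t).
  have ss : s * s^* = real_complex R t.
    by rewrite /s conj_rc -rmorphM /= -expr2 sqr_sqrtr // ltW.
  exists p, q, x, y, (fun j => s *: u j), (fun j => s *: v j); split=> //.
    by rewrite !gramZ ss scalerBr.
  by rewrite !mx_formZ ss -mulrDr mulrCA ReMl.
- move=> r [p [q [x [y [u [v [_ _ uv ->]]]]]]].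
  by apply: mx_form_matched => //; apply/eqP; rewrite -subr_eq0 -uv.
Qed.

(** [cone_functional_fin] along the polar directions, which are differences of
    Gram matrices and hence carry a bound with either sign. *)
Lemma real_sandwich k (w : R[i]) (a : 'M[ncA K1]_k) (b : 'M[ncA K2]_k) :
  (forall n (x : point1 n) (y : point2 n) u,
    0 <= complex.Re (w * (mx_form a x u + mx_form b y u))) ->
  exists l : 'M[R[i]]_k,
    (forall n (x : point1 n) u,
      complex.Re (trace_pairing l (gram u)) <= complex.Re (w * mx_form a x u)) /\
    (forall n (y : point2 n) v,
      - complex.Re (trace_pairing l (gram v)) <= complex.Re (w * mx_form b y v)).
Proof.
move=> ab0; have Pc := form_coneP ab0.
have [n1 [e eB]] := @finite_level _ _ H kappa_infinite 0.
have [s1 _] := scalar_family_exists kappa_infinite K1c K1n.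
have [s2 _] := scalar_family_exists kappa_infinite K2c K2n.
have n1F : finite_dim n1 by exists 0%N, e.
have coneI (u v : 'I_k -> H n1) : exists r, form_cone w a b (gram u - gram v) r.
  by eexists; exists n1, n1, (s1 n1), (s2 n1), u, v; split.
have [|d|l lP] := @cone_functional_fin _ _ _ (@polar_direction R k) _ Pc.
- move=> d; have [u [v ->]] := polar_direction_gram d (basis_unit ord0 eB).
  exact: coneI.
- have [u [v ->]] := polar_direction_gram d (basis_unit ord0 eB).
  by rewrite opprB; exact: coneI.
have lR (g : 'M[R[i]]_k) r : (forall i j, g j i = (g i j)^*) -> form_cone w a b g r ->
    complex.Re (trace_pairing (coord_matrix l) g) <= r.
  by move=> gH; rewrite {1}(polar_expansion gH) Re_trace_pairing; exact: lP.
exists (coord_matrix l); split=> n x u.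
  have [p [y [v [pF <- aE]]]] := finite_dim_reduction x u K1c.
  rewrite -aE; apply: lR => [i j|]; first exact: gram_hermitian.
  exists p, n1, y, (s2 n1), v, (fun=> 0); split=> //.
    by rewrite gram0 subr0.
  by rewrite mx_form0 addr0.
have [p [y [v [pF <- bE]]]] := finite_dim_reduction x u K2c.
have -> : - complex.Re (trace_pairing (coord_matrix l) (gram v)) =
    complex.Re (trace_pairing (coord_matrix l) (- gram v)).
  by rewrite trace_pairingN; case: (trace_pairing _ _).
rewrite -bE; apply: lR => [i j|].
  by rewrite !mxE rmorphN /= -inner_conj.
exists n1, p, (s1 n1), y, (fun=> 0), v; split=> //.
  by rewrite gram0 sub0r.
by rewrite mx_form0 add0r.
Qed.

End MatrixOrder.

(** * The isomorphism *)

Section Isomorphism.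
Context {R : realType} {kappa : Type} {H : hilbert_levels R kappa}.
Context {V1 V2 : operatorSpaceType R}.
Variables (K1 : ncset (ncME H V1)) (K2 : ncset (ncME H V2)).
Hypothesis kappa_infinite : infinite_set [set: kappa].
Hypotheses (K1c : nc_convex K1) (K2c : nc_convex K2).
Hypotheses (K1n : exists n, @K1 n !=set0) (K2n : exists n, @K2 n !=set0).
Local Notation K12 := (prod_ncset K1 K2).
Local Notation S1 := (ncA_opSystem K1).
Local Notation S2 := (ncA_opSystem K2).
Local Notation point1 n := (set_type (@K1 n)).
Local Notation point2 n := (set_type (@K2 n)).
Local Notation point12 n := (set_type (@prod_ncset _ _ _ _ _ K1 K2 n)).
Implicit Types (n : cardinal kappa).

(** The imaginary parts of the forms of a and b cancel at every common point, so
    the two inequalities for the imaginary parts are equalities.  Hermitian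
    parts make both pairings real; their combination is the matrix l. *)
Lemma positive_sandwich k (a : 'M[ncA K1]_k) (b : 'M[ncA K2]_k) :
  (forall n (x : point1 n) (y : point2 n) u,
    0 <= mx_form a x u + mx_form b y u) ->
  exists l : 'M[R[i]]_k,
    (forall n (x : point1 n) u,
      0 <= mx_form a x u - trace_pairing l (gram u)) /\
    (forall n (y : point2 n) v,
      0 <= mx_form b y v + trace_pairing l (gram v)).
Proof.
move=> ab0.
have Re0 (z : R[i]) : 0 <= z -> 0 <= complex.Re z /\ complex.Im z = 0.
  by case: z => x y; rewrite lecE /= => /andP[/eqP -> ->].
have ImE (z : R[i]) : complex.Re (- 'i * z) = complex.Im z.
  by rewrite mulNr; case: z => x y /=; rewrite mul0r mul1r sub0r opprK.
(* l1 bounds the real parts of the forms, l2 the imaginary parts. *)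
have [n x y u|l1 [al1 bl1]] :=
    real_sandwich (w := 1) (a := a) (b := b) kappa_infinite K1c K2c K1n K2n.
  by rewrite mul1r; have [] := Re0 _ (ab0 n x y u).
have [n x y u|l2 [al2 bl2]] :=
    real_sandwich (w := - 'i) (a := a) (b := b) kappa_infinite K1c K2c K1n K2n.
  by rewrite ImE; have [_ ->] := Re0 _ (ab0 n x y u).
have [s1 _] := scalar_family_exists kappa_infinite K1c K1n.
have [s2 _] := scalar_family_exists kappa_infinite K2c K2n.
have Im0 n (x : point1 n) (y : point2 n) u :
    complex.Im (mx_form a x u) = - complex.Im (mx_form b y u).
  apply/eqP; rewrite -subr_eq0 opprK; apply/eqP.
  by have [_] := Re0 _ (ab0 n x y u); case: mx_form => ? ?; case: mx_form => ? ?.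
have aIm n (x : point1 n) u :
    complex.Im (mx_form a x u) = complex.Re (trace_pairing l2 (gram u)).
  apply/eqP; rewrite eq_le -{2}ImE al2 andbT (Im0 n x (s2 n)) lerNl.
  by rewrite -ImE bl2.
have bIm n (y : point2 n) u :
    complex.Im (mx_form b y u) = - complex.Re (trace_pairing l2 (gram u)).
  by rewrite -(aIm n (s1 n)) (Im0 n (s1 n) y) opprK.
exists (herm_part l1 + 'i *: herm_part l2).
have lE n k' (u : 'I_k' -> H n) (m1 m2 : 'M[R[i]]_k') :
    trace_pairing (herm_part m1 + 'i *: herm_part m2) (gram u) =
    real_complex R (complex.Re (trace_pairing m1 (gram u))) +
    'i * real_complex R (complex.Re (trace_pairing m2 (gram u))).
  rewrite -!trace_pairing_herm; try exact: gram_hermitian.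
  rewrite /trace_pairing mulr_sumr -big_split; apply: eq_bigr => i _ /=.
  rewrite mulr_sumr -big_split; apply: eq_bigr => j _ /=.
  by rewrite mulrA -mulrDl; congr (_ * _); rewrite !mxE.
split=> n x u; rewrite lE.
  have := al1 n x u; rewrite mul1r -(aIm n x u) [X in 0 <= X - _](complex_rect).
  rewrite opprD addrACA subrr addr0 -rmorphB /= lecE /= eqxx /=.
  by rewrite subr_ge0.
have := bl1 n x u; rewrite mul1r [X in 0 <= X + _](complex_rect) bIm.
rewrite rmorphN mulrN addrACA addNr addr0 -rmorphD /= lecE /= eqxx /=.
by rewrite -lerBlDr sub0r.
Qed.

Lemma mx_form_scalar (X : ncspace H) (K : ncset X) k (l : 'M[R[i]]_k) n
    (x : K n) u :
  mx_form (scalar_mx_of (ncA_opSystem K) l : 'M[ncA K]_k) x u =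
  trace_pairing l (gram u).
Proof.
apply: eq_bigr => i _; apply: eq_bigr => j _; rewrite !mxE.
exact: innerZl.
Qed.

Lemma mx_formD (X : ncspace H) (K : ncset X) k (a b : 'M[ncA K]_k) n (x : K n) u :
  mx_form (a + b) x u = mx_form a x u + mx_form b x u.
Proof.
rewrite /mx_form -big_split; apply: eq_bigr => i _ /=.
rewrite -big_split; apply: eq_bigr => j _ /=; rewrite mxE; exact: innerDl.
Qed.

Lemma mx_formN (X : ncspace H) (K : ncset X) k (a : 'M[ncA K]_k) n (x : K n) u :
  mx_form (- a) x u = - mx_form a x u.
Proof.
rewrite /mx_form -sumrN; apply: eq_bigr => i _.
rewrite -sumrN; apply: eq_bigr => j _; rewrite mxE; exact: innerNl.
Qed.

Lemma ncA_posE (X : ncspace H) (K : ncset X) k (a : 'M[ncA K]_k) :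
  ncA_pos a <-> forall n (x : K n) u, 0 <= mx_form a x u.
Proof.
have E n (x : K n) u : mx_form a x u = \sum_i \sum_j
    inner (map_mx (fun f : ncA K => f n x) a i j (u j)) (u i).
  by apply: eq_bigr => i _; apply: eq_bigr => j _; rewrite mxE.
by split=> h n x u; have := h n x u; rewrite E.
Qed.

(** At level one a(x) = - b(y) for all x and y, so a and b are constant there,
    with opposite constants. *)
Lemma ncA_sum_eq0 (a : ncA K1) (b : ncA K2) : ncA_fst K2 a + ncA_snd K1 b = 0 ->
  exists c : R[i], a = c *: ncA_one K1 /\ b = - (c *: ncA_one K2).
Proof.
move=> ab0; have [n1 [e eB]] := @finite_level _ _ H kappa_infinite 0.
have [s1 _] := scalar_family_exists kappa_infinite K1c K1n.
have [s2 _] := scalar_family_exists kappa_infinite K2c K2n.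
have e1 := basis_unit ord0 eB.
have ab x y : inner (a n1 x (e ord0)) (e ord0) =
    - inner (b n1 y (e ord0)) (e ord0).
  apply/eqP; rewrite -subr_eq0 opprK; apply/eqP.
  have /(congr1 (fun f : ncA K12 =>
    inner (f n1 (prod_point x y) (e ord0)) (e ord0))) := ab0.
  rewrite [LHS]innerDl [RHS]inner0l => <-.
  by rewrite /ncA_eval /= prod_fst_point prod_snd_point.
exists (inner (a n1 (s1 n1) (e ord0)) (e ord0)); split.
  apply: (ncA_ext_line K1c.2 eB) => x.
  by rewrite [RHS]innerZl e1 mulr1 !(ab _ (s2 n1)).
apply: (ncA_ext_line K2c.2 eB) => y.
rewrite [RHS]innerNl [X in - X]innerZl e1 mulr1 (ab _ y).
by rewrite opprK.
Qed.

Lemma ncA_sum_surj (f : ncA K12) : exists a b, ncA_fst K2 a + ncA_snd K1 b = f.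
Proof.
have [n1 [e eB]] := @finite_level _ _ H kappa_infinite 0.
have [s1 s1P] := scalar_family_exists kappa_infinite K1c K1n.
have [s2 s2P] := scalar_family_exists kappa_infinite K2c K2n.
have e1 := basis_unit ord0 eB.
(* a = f(x, y0) and b - c = f(x0, y) - f(x0, y0), with y0 and x0 the scalar points *)
pose c := inner (f n1 (prod_point (s1 n1) (s2 n1)) (e ord0)) (e ord0).
pose a : ncA K1 := NcA (ncA_slice1_subproof f s2P).
pose b : ncA K2 := NcA (ncA_slice2_subproof f s1P).
exists a, (b - c *: ncA_one K2).
apply: (ncA_ext_line (prod_compr_closed K1c.2 K2c.2) eB) => z.
rewrite (prod_pointK z); move: (prod_fst z) (prod_snd z) => x y.
have := ncA_exchange kappa_infinite K1c K2c f x (s1 n1) y (s2 n1) eB.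
move=> /= E.
rewrite [LHS]innerDl [X in _ + X]innerDl [X in _ + (_ + X)]innerNl.
rewrite [X in - X]innerZl.
rewrite /ncA_eval /= prod_fst_point prod_snd_point e1 mulr1.
by apply/eqP; rewrite addrA subr_eq; apply/eqP/esym; exact: E.
Qed.

(** Defined on a representative; the choice is immaterial by [usum_to_prodE]. *)
Definition usum_to_prod (z : usum_opSystem S1 S2) : ncA_opSystem K12 :=
  ncA_fst K2 (repr z).1 + ncA_snd K1 (repr z).2.

Lemma usum_to_prodE (a : ncA K1) (b : ncA K2) :
  usum_to_prod (@usum_class R S1 S2 a b) = ncA_fst K2 a + ncA_snd K1 b.
Proof.
have [c []] := @usum_reprP R S1 S2 a b.
rewrite /usum_to_prod; move: (repr _).1 (repr _).2 => a' b'.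
move=> /eqP; rewrite subr_eq => /eqP ->; move=> /eqP; rewrite subr_eq => /eqP ->.
apply/val_inj/graded_fun_ext => n z.
transitivity ((c *: bid (H n) + a n (prod_fst z)) +
              (- (c *: bid (H n)) + b n (prod_snd z))); first by [].
by rewrite addrACA subrr add0r.
Qed.

Lemma usum_to_prod_linear : linear usum_to_prod.
Proof.
move=> c z w; have [a [b ->]] := usum_classP z; have [a' [b' ->]] := usum_classP w.
rewrite usum_classZ usum_classD !usum_to_prodE ncA_fst_linear ncA_snd_linear.
by rewrite scalerDr addrACA.
Qed.

Lemma usum_to_prod_inj : injective usum_to_prod.
Proof.
move=> z w; have [a [b ->]] := usum_classP z; have [a' [b' ->]] := usum_classP w.
rewrite !usum_to_prodE => E; apply/usum_class_eq.
apply: ncA_sum_eq0.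
transitivity ((ncA_fst K2 a + ncA_snd K1 b) - (ncA_fst K2 a' + ncA_snd K1 b')).
  by rewrite opprD addrACA; apply/val_inj/graded_fun_ext.
by rewrite E subrr.
Qed.

Lemma usum_to_prod_star z : usum_to_prod (os_star z) = os_star (usum_to_prod z).
Proof.
have [a [b ->]] := usum_classP z; rewrite /= usum_starE !usum_to_prodE.
by apply/val_inj/graded_fun_ext => n x; rewrite [RHS]adjD.
Qed.

Lemma usum_to_prod_pos k (m : 'M[usum_opSystem S1 S2]_k) :
  os_pos m <-> os_pos (map_mx usum_to_prod m).
Proof.
have formE (a : 'M[ncA K1]_k) (b : 'M[ncA K2]_k) n (z : point12 n) u :
    mx_form (map_mx usum_to_prod
      (\matrix_(i, j) @usum_class R S1 S2 (a i j) (b i j)) : 'M[ncA K12]_k) z u =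
    mx_form a (prod_fst z) u + mx_form b (prod_snd z) u.
  rewrite /mx_form -big_split; apply: eq_bigr => i _ /=.
  rewrite -big_split; apply: eq_bigr => j _ /=; rewrite !mxE usum_to_prodE.
  exact: innerDl.
split=> [[a [b [-> [l [al bl]]]]]|mpos].
  apply/ncA_posE => n z u; rewrite formE.
  have /ncA_posE/(_ n (prod_fst z) u) := al; rewrite mx_formD mx_formN mx_form_scalar.
  have /ncA_posE/(_ n (prod_snd z) u) := bl; rewrite mx_formD mx_form_scalar.
  move=> bp ap; have := addr_ge0 ap bp.
  by rewrite addrACA addNr addr0.
have /choice[ab abE] : forall p : 'I_k * 'I_k, exists ab : ncA K1 * ncA K2,
    m p.1 p.2 = @usum_class R S1 S2 ab.1 ab.2.
  by move=> p; have [a [b E]] := usum_classP (m p.1 p.2); exists (a, b).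
pose a : 'M[ncA K1]_k := \matrix_(i, j) (ab (i, j)).1.
pose b : 'M[ncA K2]_k := \matrix_(i, j) (ab (i, j)).2.
have mE : m = \matrix_(i, j) @usum_class R S1 S2 (a i j) (b i j).
  by apply/matrixP => i j; rewrite (abE (i, j)) !mxE.
have [n x y u|l [al bl]] := @positive_sandwich k a b.
  have /ncA_posE/(_ n (prod_point x y) u) := mpos.
  by rewrite mE formE prod_fst_point prod_snd_point.
exists a, b; split=> //; exists l; split.
  by apply/ncA_posE => n x u; rewrite mx_formD mx_formN mx_form_scalar.
by apply/ncA_posE => n x u; rewrite mx_formD mx_form_scalar.
Qed.

Lemma usum_to_prod_iso : complete_order_iso usum_to_prod.
Proof.
split; first exact: usum_to_prod_linear.
- have /choice[g gK] f : exists z, usum_to_prod z = f.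
    have [a [b <-]] := ncA_sum_surj f.
    by exists (@usum_class R S1 S2 a b); exact: usum_to_prodE.
  by exists g => // z; apply: usum_to_prod_inj; rewrite gK.
- rewrite /= usum_to_prodE; apply/val_inj/graded_fun_ext => n z.
  exact: addr0.
- exact: usum_to_prod_star.
- exact: usum_to_prod_pos.
Qed.

End Isomorphism.

Theorem proposition3p1 (R : realType) (kappa : Type)
  (H : hilbert_levels R kappa) (V1 V2 : operatorSpaceType R)
  (K1 : ncset (ncME H V1)) (K2 : ncset (ncME H V2))
  (kappa_infinite : infinite_set [set: kappa])
  (kappa_dense1 : exists2 D : set V1, D #<= [set: kappa] & dense D)
  (kappa_dense2 : exists2 D : set V2, D #<= [set: kappa] & dense D)
  (hK1 : compact_nc_convex K1) (hK2 : compact_nc_convex K2) :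
  exists Phi : usum_opSystem (ncA_opSystem K1) (ncA_opSystem K2) ->
               ncA_opSystem (prod_ncset K1 K2),
    complete_order_iso Phi /\
    forall (a : ncA K1) (b : ncA K2) n (x : K1 n) (y : K2 n),
      (Phi (@usum_class R (ncA_opSystem K1) (ncA_opSystem K2) a b)
        : ncA (prod_ncset K1 K2)) n (sigT_of_setX (K1 n) (K2 n) (x, y)) =
      a n x + b n y.
Proof.
have [[K1c _ K1n] [K2c _ K2n]] := (hK1, hK2).
exists (@usum_to_prod R kappa H V1 V2 K1 K2); split.
  exact: usum_to_prod_iso.
move=> a b n x y; rewrite usum_to_prodE.
transitivity (a n (prod_fst (prod_point x y)) + b n (prod_snd (prod_point x y))).
  by [].
by rewrite prod_fst_point prod_snd_point.
Qed.
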